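(* Let $G\le\mathrm{GL}_4(\mathbb{Z})$ be the finite group with GAP ID $[4,25,8,5]$, generated by $$g_1=\begin{pmatrix}-1&0&0&0\\0&-1&0&0\\0&0&0&-1\\0&0&-1&0\end{pmatrix},\ g_2=\begin{pmatrix}1&0&1&0\\0&0&1&0\\0&0&0&1\\0&-1&0&0\end{pmatrix},\ g_3=\begin{pmatrix}1&-1&1&0\\0&-1&0&0\\0&0&-1&0\\0&0&0&1\end{pmatrix},\ g_4=\begin{pmatrix}1&0&1&1\\0&1&0&0\\0&0&-1&0\\0&0&0&-1\end{pmatrix}.$$ Then the corresponding $G$-lattice $M_4=\mathbb{Z}^4$ is quasi-permutation; that is, the algebraic torus corresponding to $[4,25,8,5]$ is stably rational.
   Context: All fields $k$ have characteristic $0$. $M_4=\bigoplus_{i=1}^4\mathbb{Z}\mathbf e_i$ (row vectors) with $g=(a_{ij})$ acting by $\mathbf e_i\mapsto\sum_ja_{ij}\mathbf e_j$. A permutation $G$-lattice is one with a $\mathbb{Z}$-basis permuted by $G$; a $G$-lattice $M$ is quasi-permutation if there is an exact sequence of $G$-lattices $0\to M\to P\to Q\to0$ with $P,Q$ permutation. The torus corresponding to $G$ is $\mathrm{Spec}(L[M_4]^G)$ for a Galois extension $L/k$ with group $G$; it is stably $k$-rational iff $M_4$ is quasi-permutation (known theorem of Endo–Miyata and Voskresenskii). *)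

(* Defs.v *)
From HB Require Import structures.
From mathcomp Require Import all_boot all_order all_fingroup all_algebra.
From mathcomp Require Import all_solvable all_field all_character finmap.
From mathcomp.multinomials Require Import monalg.

Set Implicit Arguments.
Unset Strict Implicit.
Unset Printing Implicit Defensive.

Import GRing.Theory.
Local Open Scope fset_scope.
Local Open Scope ring_scope.

(* A G-lattice of rank n with a chosen Z-basis is an mx_representation int G n:
   g acts on row vectors by u |-> u *m M g, so that the i-th basis vector is
   sent to the i-th row of M g. *)

(* The rows of B form a Z-basis of Z^n which is permuted by G. *)
Definition permutation_lattice (gT : finGroupType) (G : {group gT}) (n : nat)
    (M : mx_representation int G n) : Prop :=
  exists2 B : 'M[int]_n, B \in unitmx &
    forall g, g \in G -> forall i, exists j, row i B *m M g = row j B.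

(* 0 -> M -> P -> Q -> 0 with P and Q permutation; the two maps are given by
   their matrices, acting on row vectors from the right. *)
Definition quasi_permutation_lattice (gT : finGroupType) (G : {group gT})
    (n : nat) (M : mx_representation int G n) : Prop :=
  exists (p q : nat)
    (P : mx_representation int G p) (Q : mx_representation int G q)
    (i : 'M[int]_(n, p)) (s : 'M[int]_(p, q)),
    [/\ permutation_lattice P,
        permutation_lattice Q,
        forall g, g \in G -> M g *m i = i *m P g,
        forall g, g \in G -> P g *m s = s *m Q g &
        [/\ forall u : 'rV[int]_n, u *m i = 0 -> u = 0,
            forall v : 'rV[int]_p,
              v *m s = 0 <-> exists u : 'rV[int]_n, v = u *m i &
            forall w : 'rV[int]_q, exists v : 'rV[int]_p, w = v *m s]].

(* The group algebra R[M] of an abelian group M, written additively: the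
   elements are the finitely supported functions M -> R, << c *g u >> is the
   monomial c x^u, and x^u * x^v = x^(u + v).  (The ring structure that the
   library puts on {malg R[K]} needs a monoid K without nontrivial units.) *)
Definition group_algebra (R : comNzRingType) (M : zmodType) : Type :=
  {malg R[M]}.

Section GroupAlgebra.
Context (R : comNzRingType) (M : zmodType).

HB.instance Definition _ := GRing.Lmodule.on (group_algebra R M).

Implicit Types a b c : group_algebra R M.

Definition galg_one : group_algebra R M := << 1 *g (0 : M) >>.

Definition galg_mul a b : group_algebra R M :=
  \sum_(u <- msupp a) \sum_(v <- msupp b) << a@_u * b@_v *g u + v >>.

Lemma galg_mulw (d1 d2 : {fset M}) a b :
  msupp a `<=` d1 -> msupp b `<=` d2 ->
  galg_mul a b = \sum_(u <- d1) \sum_(v <- d2) << a@_u * b@_v *g u + v >>.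
Proof.
move=> le1 le2; rewrite /galg_mul (big_fset_incl _ le1) /=.
  apply/eq_bigr => u _; apply/big_fset_incl => // v _ /mcoeff_outdom ->.
  by rewrite mulr0 monalgU0.
move=> u _ /mcoeff_outdom au; rewrite big1 // => v _.
by rewrite au mul0r monalgU0.
Qed.

Lemma galg_mulC : commutative galg_mul.
Proof.
move=> a b; rewrite /galg_mul exchange_big /=.
by apply/eq_bigr => u _; apply/eq_bigr => v _; rewrite mulrC addrC.
Qed.

Lemma galg_mulUU (x y : R) (u v : M) :
  galg_mul << x *g u >> << y *g v >> = << x * y *g u + v >>.
Proof. by rewrite (galg_mulw msuppU_le msuppU_le) !big_seq_fset1 !mcoeffUU. Qed.

Lemma galg_mulDl : left_distributive galg_mul +%R.
Proof.
move=> a b c.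
rewrite (galg_mulw (msuppD_le a b) (fsubset_refl (msupp c))).
rewrite (galg_mulw (fsubsetUl (msupp a) (msupp b)) (fsubset_refl (msupp c))).
rewrite (galg_mulw (fsubsetUr (msupp a) (msupp b)) (fsubset_refl (msupp c))).
rewrite -big_split /=; apply/eq_bigr => u _.
rewrite -big_split /=; apply/eq_bigr => v _.
by rewrite mcoeffD mulrDl monalgUD.
Qed.

Lemma galg_mulDr : right_distributive galg_mul +%R.
Proof. by move=> a b c; rewrite galg_mulC galg_mulDl !(galg_mulC _ a). Qed.

Lemma galg_mul0l : left_zero 0 galg_mul.
Proof. by move=> a; rewrite /galg_mul msupp0 big_seq_fset0. Qed.

Lemma galg_mul0r : right_zero 0 galg_mul.
Proof. by move=> a; rewrite galg_mulC galg_mul0l. Qed.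

Lemma galg_mul_suml (I : Type) (s : seq I) (F : I -> group_algebra R M) b :
  galg_mul (\sum_(i <- s) F i) b = \sum_(i <- s) galg_mul (F i) b.
Proof.
exact: (big_morph (galg_mul^~ b) (fun _ _ => galg_mulDl _ _ _) (galg_mul0l b)).
Qed.

Lemma galg_mul_sumr (I : Type) (s : seq I) (F : I -> group_algebra R M) a :
  galg_mul a (\sum_(i <- s) F i) = \sum_(i <- s) galg_mul a (F i).
Proof.
exact: (big_morph (galg_mul a) (fun _ _ => galg_mulDr _ _ _) (galg_mul0r a)).
Qed.

Lemma galg_mul1l : left_id galg_one galg_mul.
Proof.
move=> a; rewrite {1}[a]monalgE galg_mul_sumr [RHS]monalgE.
by apply/eq_bigr => u _; rewrite galg_mulUU mul1r add0r.
Qed.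

Lemma galg_mulA : associative galg_mul.
Proof.
have mulUUA x y u v c : galg_mul << x *g u >> (galg_mul << y *g v >> c) =
    galg_mul (galg_mul << x *g u >> << y *g v >>) c.
  rewrite [c]monalgE [X in galg_mul _ X = _]galg_mul_sumr 2!galg_mul_sumr.
  apply/eq_bigr => w _.
  by rewrite !galg_mulUU mulrA addrA.
have mulUA x u b c : galg_mul << x *g u >> (galg_mul b c) =
    galg_mul (galg_mul << x *g u >> b) c.
  rewrite [b]monalgE [X in galg_mul _ X = _]galg_mul_suml.
  rewrite [X in _ = galg_mul X _]galg_mul_sumr galg_mul_sumr galg_mul_suml.
  by apply/eq_bigr => v _; rewrite mulUUA.
move=> a b c; rewrite [a]monalgE [X in _ = galg_mul X _]galg_mul_suml.
rewrite 2!galg_mul_suml.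
by apply/eq_bigr => u _; rewrite mulUA.
Qed.

Lemma galg_one_neq0 : galg_one != 0.
Proof. by rewrite monalgU_eq0 oner_eq0. Qed.

HB.instance Definition _ :=
  GRing.Zmodule_isComNzRing.Build (group_algebra R M)
    galg_mulA galg_mulC galg_mul1l galg_mulDl galg_one_neq0.

Section SemilinearMap.
Context (f : {rmorphism R -> R}) (h : {additive M -> M}).

(* sum_u a_u x^u |-> sum_u f(a_u) x^(h u) *)
Definition galg_map a : group_algebra R M :=
  \sum_(u <- msupp a) << f a@_u *g h u >>.

Lemma galg_mapw (d : {fset M}) a :
  msupp a `<=` d -> galg_map a = \sum_(u <- d) << f a@_u *g h u >>.
Proof.
move=> le; rewrite /galg_map (big_fset_incl _ le) // => u _ /mcoeff_outdom ->.
by rewrite rmorph0 monalgU0.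
Qed.

Lemma galg_mapU (x : R) (u : M) : galg_map << x *g u >> = << f x *g h u >>.
Proof. by rewrite (galg_mapw msuppU_le) big_seq_fset1 mcoeffUU. Qed.

Lemma galg_mapD : {morph galg_map : a b / a + b}.
Proof.
move=> a b; rewrite (galg_mapw (msuppD_le a b)).
rewrite (galg_mapw (fsubsetUl (msupp a) (msupp b))).
rewrite (galg_mapw (fsubsetUr (msupp a) (msupp b))) -big_split /=.
by apply/eq_bigr => u _; rewrite mcoeffD rmorphD monalgUD.
Qed.

Lemma galg_map0 : galg_map 0 = 0.
Proof. by rewrite /galg_map msupp0 big_seq_fset0. Qed.

Lemma galg_map_sum (I : Type) (s : seq I) (F : I -> group_algebra R M) :
  galg_map (\sum_(i <- s) F i) = \sum_(i <- s) galg_map (F i).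
Proof. exact: (big_morph galg_map galg_mapD galg_map0). Qed.

Lemma galg_mapN : {morph galg_map : a / - a}.
Proof. by move=> a; apply/eqP; rewrite -addr_eq0 -galg_mapD addNr galg_map0. Qed.

Lemma galg_map1 : galg_map 1 = 1.
Proof. by rewrite galg_mapU rmorph1 raddf0. Qed.

Lemma galg_mapM : {morph galg_map : a b / a * b}.
Proof.
move=> a b; rewrite [a * b]/(galg_mul a b) galg_map_sum.
rewrite -[galg_map a * _]/(galg_mul (galg_map a) (galg_map b)).
rewrite [X in galg_mul X _]/galg_map galg_mul_suml; apply/eq_bigr => u _.
rewrite galg_map_sum [X in galg_mul _ X]/galg_map galg_mul_sumr.
by apply/eq_bigr => v _; rewrite galg_mapU galg_mulUU rmorphM raddfD.
Qed.

End SemilinearMap.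
End GroupAlgebra.

(* A finite extension L/k and an action of Gal(L/k) on Z^n through rho. *)
Section Torus.
Context (k : fieldType) (L : splittingFieldType k) (n : nat).
Variable rho : gal_of {:L} -> 'M[int]_n.

(* g acts on L[Z^n] by c x^u |-> g(c) x^(u *m rho g). *)
Definition torus_act (g : gal_of {:L}) :
    group_algebra L 'rV[int]_n -> group_algebra L 'rV[int]_n :=
  galg_map (gal_repr g) (mulmxr (rho g)).

Definition torus_invariant : {pred group_algebra L 'rV[int]_n} :=
  [pred a | [forall g in 'Gal({:L} / 1)%g, torus_act g a == a]].

Fact torus_invariant_subring : subring_closed torus_invariant.
Proof.
split=> [|a b /forall_inP Ia /forall_inP Ib|a b /forall_inP Ia /forall_inP Ib];
  apply/forall_inP => g Gg; apply/eqP.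
- exact: galg_map1.
- rewrite [LHS]galg_mapD galg_mapN.
  by congr (_ - _); apply/eqP; [apply: Ia | apply: Ib].
- rewrite [LHS]galg_mapM.
  by congr (_ * _); apply/eqP; [apply: Ia | apply: Ib].
Qed.

HB.instance Definition _ :=
  GRing.isSubringClosed.Build (group_algebra L 'rV[int]_n) torus_invariant
    torus_invariant_subring.

(* The coordinate ring L[Z^n]^Gal(L/k) of the torus. *)
Record torus_ring : Type := TorusRing
  { torus_ring_val :> group_algebra L 'rV[int]_n;
    _ : torus_ring_val \in torus_invariant }.

HB.instance Definition _ := [isSub for torus_ring_val].
HB.instance Definition _ := [Choice of torus_ring by <:].
HB.instance Definition _ := [SubChoice_isSubComNzRing of torus_ring by <:].

Fact torus_const_subproof (c : k) :
  (<< c%:A *g (0 : 'rV[int]_n) >> : group_algebra L 'rV[int]_n)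
    \in torus_invariant.
Proof.
apply/forall_inP => g Gg; apply/eqP; rewrite /torus_act galg_mapU raddf0.
by rewrite /= linearZ /= rmorph1.
Qed.

Definition torus_const (c : k) : torus_ring :=
  TorusRing (torus_const_subproof c).

End Torus.

(* Imported only here: it overrides notations used above for {malg R[M]}. *)
From mathcomp.multinomials Require Import mpoly.

(* Spec A is stably rational over k, for a k-algebra A with structure map
   iota: for some n and m, Spec A x A^n is birational to A^m over k, i.e.
   k(y_1, ..., y_m) is a field of fractions of A[t_1, ..., t_n], compatibly
   with the k-algebra structures. *)
Definition stably_rational (k : fieldType) (A : comNzRingType) (iota : k -> A)
    : Prop :=
  exists (n m : nat) (f : {rmorphism mpoly n A -> {fraction mpoly m k}}),
    [/\ injective f,
        forall c : k, f (mpolyC n (iota c)) = tofrac (mpolyC m c) &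
        forall z, exists a b, b != 0 /\ z = f a / f b].

Definition torus_stably_rational (k : fieldType) (L : splittingFieldType k)
    (n : nat) (rho : gal_of {:L} -> 'M[int]_n) : Prop :=
  stably_rational (torus_const rho).

(* Integer matrices with the given rows. *)
Definition mx_of_rows (n : nat) (s : seq (seq int)) : 'M[int]_n :=
  \matrix_(i < n, j < n) nth 0 (nth [::] s i) j.

Definition rows1 : seq (seq int) :=
  [:: [:: 1; 0; 0; 0]; [:: 0; 1; 0; 0]; [:: 0; 0; 1; 0]; [:: 0; 0; 0; 1]].

Definition rows_g1 : seq (seq int) :=
  [:: [:: -1;  0;  0;  0];
      [::  0; -1;  0;  0];
      [::  0;  0;  0; -1];
      [::  0;  0; -1;  0]].

Definition rows_g2 : seq (seq int) :=
  [:: [::  1;  0;  1;  0];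
      [::  0;  0;  1;  0];
      [::  0;  0;  0;  1];
      [::  0; -1;  0;  0]].

Definition rows_g3 : seq (seq int) :=
  [:: [::  1; -1;  1;  0];
      [::  0; -1;  0;  0];
      [::  0;  0; -1;  0];
      [::  0;  0;  0;  1]].

Definition rows_g4 : seq (seq int) :=
  [:: [::  1;  0;  1;  1];
      [::  0;  1;  0;  0];
      [::  0;  0; -1;  0];
      [::  0;  0;  0; -1]].

(* The product of 4 x 4 matrices in list form; unlike *m, it evaluates. *)
Definition rows_mul (s t : seq (seq int)) : seq (seq int) :=
  let e i j k := nth 0 (nth [::] s i) k * nth 0 (nth [::] t k) j in
  mkseq (fun i => mkseq (fun j => e i j 0%N + e i j 1%N + e i j 2 + e i j 3) 4)
    4.

Lemma mx_of_rows1 : mx_of_rows 4 rows1 = 1%:M.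
Proof. by apply/matrixP; do 2![case; do 4?[case=> //] => ?]; rewrite !mxE. Qed.

Lemma mx_of_rowsM (s t : seq (seq int)) :
  mx_of_rows 4 (rows_mul s t) = mx_of_rows 4 s *m mx_of_rows 4 t.
Proof.
apply/matrixP => i j; rewrite !mxE !big_ord_recr big_ord0 /= add0r !mxE /=.
by rewrite /rows_mul (nth_mkseq _ _ (ltn_ord i)) (nth_mkseq _ _ (ltn_ord j)).
Qed.

(* A list of all the products of g1, ..., g4; it is only used to obtain a
   finite type of matrices. *)
Definition rows_elts : seq (seq (seq int)) :=
  iter 8 (fun s => undup (s ++ [seq rows_mul a b | a <- s,
                                 b <- [:: rows_g1; rows_g2; rows_g3; rows_g4]]))
    [:: rows1].

Lemma rows_elts_mul : allrel (fun s t => rows_mul s t \in rows_elts)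
                        rows_elts rows_elts.
Proof. by vm_compute. Qed.

Lemma rows_elts_inv :
  all (fun s => has (fun t => rows_mul t s == rows1) rows_elts) rows_elts.
Proof. by vm_compute. Qed.

Lemma rows_elts_gen :
  all (mem rows_elts) [:: rows1; rows_g1; rows_g2; rows_g3; rows_g4].
Proof. by vm_compute. Qed.

Definition mx_elts : seq 'M[int]_4 := [seq mx_of_rows 4 s | s <- rows_elts].

Definition mx_grp : Type := seq_sub mx_elts.

HB.instance Definition _ := Finite.on mx_grp.
HB.instance Definition _ := SubFinite.on mx_grp.

Fact mx_grp_mul_subproof (A B : mx_grp) : val A *m val B \in mx_elts.
Proof.
have /mapP[s Hs ->] := valP A; have /mapP[t Ht ->] := valP B.
rewrite -mx_of_rowsM; apply: map_f; exact: (allrelP rows_elts_mul).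
Qed.

Fact mx_grp_inv_ex (A : mx_grp) : exists2 B, B \in mx_elts & B *m val A = 1%:M.
Proof.
have /mapP[s Hs ->] := valP A.
have /hasP[t Ht /eqP ts1] := allP rows_elts_inv _ Hs.
exists (mx_of_rows 4 t); first exact: map_f.
by rewrite -mx_of_rowsM ts1 mx_of_rows1.
Qed.

Fact mx_grp_inv_subproof (A : mx_grp) : invmx (val A) \in mx_elts.
Proof.
have [B HB BA1] := mx_grp_inv_ex A; have [_ uA] := mulmx1_unit BA1.
by rewrite -[invmx _]mul1mx -BA1 mulmxK.
Qed.

Fact mx_grp_gen_subproof (s : seq (seq int)) :
  s \in [:: rows1; rows_g1; rows_g2; rows_g3; rows_g4] ->
  mx_of_rows 4 s \in mx_elts.
Proof. by move=> Hs; apply: map_f; exact: (allP rows_elts_gen _ Hs). Qed.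

Fact mx_grp_one_subproof : 1%:M \in mx_elts.
Proof. by rewrite -mx_of_rows1; apply: mx_grp_gen_subproof. Qed.

Definition mx_grp_mul (A B : mx_grp) : mx_grp :=
  SeqSub (mx_grp_mul_subproof A B).
Definition mx_grp_one : mx_grp := SeqSub mx_grp_one_subproof.
Definition mx_grp_inv (A : mx_grp) : mx_grp := SeqSub (mx_grp_inv_subproof A).

Fact mx_grp_mulA : associative mx_grp_mul.
Proof. by move=> A B C; apply: val_inj; apply: mulmxA. Qed.

Fact mx_grp_mul1 : left_id mx_grp_one mx_grp_mul.
Proof. by move=> A; apply: val_inj; apply: mul1mx. Qed.

Fact mx_grp_mulV : left_inverse mx_grp_one mx_grp_inv mx_grp_mul.
Proof.
move=> A; apply: val_inj => /=; apply: mulVmx.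
by have [B _ /mulmx1_unit[]] := mx_grp_inv_ex A.
Qed.

HB.instance Definition _ :=
  Finite_isGroup.Build mx_grp mx_grp_mulA mx_grp_mul1 mx_grp_mulV.

Definition g1 : mx_grp := SeqSub (@mx_grp_gen_subproof rows_g1 isT).
Definition g2 : mx_grp := SeqSub (@mx_grp_gen_subproof rows_g2 isT).
Definition g3 : mx_grp := SeqSub (@mx_grp_gen_subproof rows_g3 isT).
Definition g4 : mx_grp := SeqSub (@mx_grp_gen_subproof rows_g4 isT).

Definition G_4_25_8_5 : {group mx_grp} := <<[set g1; g2; g3; g4]>>%G.

Fact M4_repr : mx_repr G_4_25_8_5 (fun g : mx_grp => \val g).
Proof. by split. Qed.

Definition M4 : mx_representation int G_4_25_8_5 4 := MxRepresentation M4_repr.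

(* Main.v *)
From HB Require Import structures.
Require Import Defs.
From mathcomp Require Import all_boot all_order all_fingroup all_algebra.
From mathcomp Require Import all_solvable all_field all_character.
From mathcomp Require Import finmap zify.
From mathcomp.multinomials Require Import monalg.
From mathcomp.multinomials Require Import mpoly.

Set Implicit Arguments.
Unset Strict Implicit.
Unset Printing Implicit Defensive.

Import Order.TTheory GRing.Theory Num.Theory.
Local Open Scope fset_scope.
Local Open Scope ring_scope.

(** The proof has two independent halves: an explicit resolution of the
    lattice, and the theorem that a torus whose character lattice is
    quasi-permutation is stably rational.

    The lattice.  The rows e_2, e_3, e_4 span a sublattice on which G acts by
    all signed permutations of the coordinates, and G acts on the quotient by
    the sign of the underlying permutation of the three axes.  Dually, M_4^*
    consists of the vectors (a e_0 + sum_i b_i v_i) / 2 with a + sum_i b_i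
    even, where G permutes the vectors +-v_i and sends e_0 to +-e_0.  The two
    vectors +-e_0 and the twelve vectors (+-e_0 +- v_i) / 2 span M_4^*.  The
    kernel K of the resulting surjection from a permutation lattice of rank 14
    is generated by a permuted family of 13 relations, six of the form
    x + (-x), six expressing +-e_0 as a sum of two of the twelve vectors, and
    e_0 + (-e_0).  These 13 generators satisfy three linear relations, one for
    each axis, and that presentation of K splits equivariantly: K plus the
    permutation lattice on the three axes is free on a permuted basis of 13
    elements.  Dualizing gives 0 -> M_4 -> P -> Q -> 0 with P and Q permutation
    of ranks 17 and 13; all the identities involved are between explicit
    integer matrices and are decided by computation ([M4_quasi_permutation]).

    The torus.  Let 0 -> M -> P -> Q -> 0 be such a resolution, with G the
    Galois group of L/k, and let E be the field of fractions of
    L[y_1, ..., y_p], where G acts on coefficients only, so that the fixed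
    field of E is k(y_1, ..., y_p) ([ff_gal_fixed]).  Galois descent for the
    permutation module P ([permuted_coordinates]) replaces the y_r by linear
    combinations x_j over L that are permuted by G as the basis of P is.  The
    Laurent monomials in the x_j are linearly independent over L, so L[P]
    embeds equivariantly in E, and so does L[M].  Lifting the permuted basis of
    Q to P gives q monomials F_l that are algebraically independent over L[M]
    and that G permutes up to monomials of M; descent again replaces them by
    G-invariant combinations t_r = sum_l B_(r,l) F_l with B an invertible
    matrix with entries in L[M] ([descent_generators]).  The t_r are still
    algebraically independent over L[M], and the fractions of
    L[M][t_1, ..., t_q] fill E.  Taking invariants, with a norm to make
    denominators invariant and an element of trace one to make coefficients
    invariant ([invariant_fraction]), k(y_1, ..., y_p) is the field of
    fractions of L[M]^G[t_1, ..., t_q] ([stably_rational_model]). *)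

(** * Fraction fields and polynomials *)

Section FractionLift.
Context (D : idomainType) (K : fieldType) (psi : {rmorphism D -> K}).
Lemma fracE (z : {fraction D}) :
  z = tofrac (\n_(generic_quotient.repr z)) /
      tofrac (\d_(generic_quotient.repr z)).
Proof.
have dn0 : tofrac (\d_(generic_quotient.repr z)) != 0.
  by rewrite tofrac_eq0 denom_ratioP.
apply: (canRL (mulfK dn0)).
set r := generic_quotient.repr z; rewrite -[z]reprK -/r.
unlock tofrac.
rewrite -[LHS]FracField.pi_mul; apply/eqmodP.
have r0 : \d_r != 0 by apply: denom_ratioP.
have e1 : \d_r * \d_(Ratio \d_r 1) != 0.
  by rewrite denom_Ratio ?mulr1 ?oner_neq0.
rewrite /= FracField.equivfE /FracField.mulf /= numer_Ratio // denom_Ratio //.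
rewrite !numer_Ratio ?oner_neq0 // !denom_Ratio ?oner_neq0 //
  ?mulr1 ?oner_neq0 //.
  by rewrite mulrC.
exact: oner_neq0.
Qed.

(** Injectivity is an argument, so that the extension is a ring morphism without
    further conditions. *)
Definition frac_lift (_ : injective psi) (z : {fraction D}) : K :=
  psi (\n_(generic_quotient.repr z)) / psi (\d_(generic_quotient.repr z)).

Hypothesis psi_inj : injective psi.
Local Notation lift := (frac_lift psi_inj).

Lemma psi_neq0 x : x != 0 -> psi x != 0.
Proof. by rewrite -(inj_eq psi_inj) rmorph0. Qed.

Lemma frac_liftE (a b : D) : b != 0 ->
  lift (tofrac a / tofrac b) = psi a / psi b.
Proof.
move=> b0; rewrite /frac_lift; set z := tofrac a / tofrac b.
have d0 : \d_(generic_quotient.repr z) != 0 by rewrite denom_ratioP.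
have := fracE z; rewrite {1}/z => /eqP.
rewrite eqr_div ?tofrac_eq0 // -!tofracM tofrac_eq => /eqP e.
by apply/eqP; rewrite eqr_div ?psi_neq0 // -!rmorphM -e mulrC.
Qed.

Lemma frac_lift_tofrac a : lift (tofrac a) = psi a.
Proof.
by have := @frac_liftE a 1 (oner_neq0 _); rewrite tofrac1 rmorph1 !divr1.
Qed.

Fact frac_lift_is_zmod_morphism : zmod_morphism lift.
Proof.
move=> y z; rewrite [y]fracE [z]fracE.
move: (denom_ratioP (generic_quotient.repr y)).
move: (denom_ratioP (generic_quotient.repr z)).
move: (_.1) (_.2) (_.1) (_.2) => a b c d d0 b0.
rewrite -mulNr addf_div ?tofrac_eq0 // -tofracN -!tofracM -tofracD.
rewrite !frac_liftE ?mulf_neq0 // -mulNr addf_div ?psi_neq0 //.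
by rewrite !rmorphD !rmorphM rmorphN.
Qed.

Fact frac_lift_is_monoid_morphism : monoid_morphism lift.
Proof.
split=> [|y z]; first by rewrite -tofrac1 frac_lift_tofrac rmorph1.
rewrite [y]fracE [z]fracE.
move: (denom_ratioP (generic_quotient.repr y)).
move: (denom_ratioP (generic_quotient.repr z)).
move: (_.1) (_.2) (_.1) (_.2) => a b c d d0 b0.
by rewrite mulf_div -!tofracM !frac_liftE ?mulf_neq0 // mulf_div !rmorphM.
Qed.

HB.instance Definition _ := GRing.isZmodMorphism.Build {fraction D} K lift
  frac_lift_is_zmod_morphism.
HB.instance Definition _ := GRing.isMonoidMorphism.Build {fraction D} K lift
  frac_lift_is_monoid_morphism.
End FractionLift.

Lemma frac_morph_ext (D : idomainType) (K : fieldType)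
    (f g : {rmorphism {fraction D} -> K}) :
  (forall a, f (tofrac a) = g (tofrac a)) -> f =1 g.
Proof. by move=> e z; rewrite [z]fracE !fmorph_div /= !e. Qed.

Lemma tofrac_inj (D : idomainType) : injective (@FracField.tofrac D).
Proof. by move=> a b /eqP; rewrite tofrac_eq => /eqP. Qed.

Lemma rmorph_mmap (R S T : comNzRingType) (n : nat) (f : {rmorphism R -> S})
    (h : 'I_n -> S) (g : {rmorphism S -> T}) (p : mpoly n R) :
  g (mmap f h p) = mmap (g \o f) (g \o h) p.
Proof.
rewrite /mmap rmorph_sum; apply/eq_bigr => m _.
rewrite rmorphM rmorph_prod; congr (_ * _).
by apply/eq_bigr => i _; rewrite rmorphXn.
Qed.

Lemma eq_mmap (R S : nzRingType) (n : nat) (f f' : R -> S) (h h' : 'I_n -> S)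
    (p : mpoly n R) :
  f =1 f' -> h =1 h' -> mmap f h p = mmap f' h' p.
Proof.
move=> ef eh; rewrite /mmap; apply/eq_bigr => m _; rewrite ef.
by congr (_ * _); apply/eq_bigr => i _; rewrite eh.
Qed.

Lemma map_mpoly_inj (R S : nzRingType) (n : nat) (f : {rmorphism R -> S}) :
  injective f -> injective (map_mpoly f : mpoly n R -> mpoly n S).
Proof.
move=> f_inj p r e; apply/mpolyP => m; apply: f_inj.
by rewrite -!mcoeff_map_mpoly e.
Qed.

Lemma mmap_mpolyX (R : comNzRingType) (n : nat) (p : mpoly n R) :
  mmap (@mpolyC n R) (fun i => 'X_i) p = p.
Proof.
rewrite [RHS]mpolyE; apply/eq_bigr => m _.
rewrite mul_mpolyC; congr (_ *: _).
by rewrite mpolyXE_id.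
Qed.

Lemma map_mpolyEmmap (R S : comNzRingType) (n : nat) (f : {rmorphism R -> S})
   (p : mpoly n R) : mmap (@mpolyC n S \o f) (fun i => 'X_i) p = map_mpoly f p.
Proof. by []. Qed.

(** An algebraically independent family stays so after an invertible linear
    change of variables: substituting in p over E the linear forms that are
    inverse to B turns p(B X) back into p, so p(B X) = 0 forces p = 0.  The
    entries of B lie in R but those of its inverse need not. *)
Lemma mmap_inj_linear (R : comNzRingType) (E : fieldType) (n : nat)
    (phi : {rmorphism R -> E}) (x y : 'I_n -> E) (B : 'M[R]_n) :
  injective phi -> map_mx phi B \in unitmx ->
  (forall r, y r = \sum_l phi (B r l) * x l) ->
  injective (mmap phi x) -> injective (mmap phi y).
Proof.
move=> phi_inj uB yE inj_x.
pose Y r : mpoly n R := \sum_l B r l *: 'X_l.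
have x_Y p : mmap phi y p = mmap phi x (mmap (@mpolyC n R) Y p).
  rewrite rmorph_mmap; apply: eq_mmap => [c | r] /=; first by rewrite mmapC.
  rewrite yE raddf_sum /=; apply/eq_bigr => l _.
  by rewrite mmapZ mmapX mmap1U.
pose Z l : mpoly n E := \sum_r (invmx (map_mx phi B)) l r *: 'X_r.
have ZY p : mmap (@mpolyC n E \o phi) Z (mmap (@mpolyC n R) Y p) =
    map_mpoly phi p.
  rewrite rmorph_mmap -map_mpolyEmmap; apply: eq_mmap => [c | r] /=.
    by rewrite mmapC.
  rewrite raddf_sum /=.
  under eq_bigr do rewrite mmapZ mmapX mmap1U /= mul_mpolyC scaler_sumr.
  rewrite exchange_big /= (bigD1 r) //= [X in _ + X]big1 ?addr0 => [|i ir].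
    under eq_bigr do rewrite scalerA.
    rewrite -scaler_suml; have /matrixP/(_ r r) := mulmxV uB; rewrite !mxE eqxx.
    by under eq_bigr do rewrite mxE; move->; rewrite scale1r.
  under eq_bigr do rewrite scalerA.
  rewrite -scaler_suml; have /matrixP/(_ r i) := mulmxV uB.
  rewrite !mxE eq_sym (negbTE ir).
  by under eq_bigr do rewrite mxE; move->; rewrite scale0r.
move=> p r; rewrite !x_Y => /inj_x e.
by apply: (map_mpoly_inj phi_inj); rewrite -!ZY e.
Qed.

Lemma mpoly_lift (R S : nzRingType) (n : nat) (f : {rmorphism R -> S})
    (a : mpoly n S) :
  (forall m, exists r, a@_m = f r) -> exists a', a = map_mpoly f a'.
Proof.
move=> af; rewrite [a]mpolyE; apply: (big_ind (fun b => exists a', b = _ a')).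
- by exists 0; rewrite raddf0.
- by move=> _ _ [b ->] [c ->]; exists (b + c); rewrite raddfD.
move=> m _; have [r ->] := af m; exists (r *: 'X_[m]).
by rewrite map_mpolyZ map_mpolyX.
Qed.

(** * Galois descent *)

Section GaloisDescent.
Context (k : fieldType) (L : splittingFieldType k).
Local Notation Gal := ('Gal({:L} / 1)%g).

Lemma mem_gal (g : gal_of {:L}) : g \in Gal.
Proof. by rewrite gal_kHom ?sub1v // k1HomE ahomWin. Qed.

Lemma gal_mulE (g h : gal_of {:L}) (c : L) : (g * h)%g c = h (g c).
Proof. by rewrite galM ?memvf. Qed.

(** By the independence of characters the rows of the matrix (g b_j) are
    linearly independent; the coefficients b'_j are the column of a right
    inverse indexed by the identity. *)
Lemma gal_dual_basis :
  exists (d : nat) (b b' : 'I_d -> L),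
    forall g : gal_of {:L}, \sum_j b' j * g (b j) = (g == 1%g)%:R.
Proof.
pose d := \dim {:L}; pose b (j : 'I_d) : L := (vbasis {:L})`_j.
pose D : 'M[L]_(#|{: gal_of {:L}}|, d) :=
  \matrix_(i, j) (enum_val i : gal_of {:L}) (b j).
have freeD : row_free D.
  apply: inj_row_free => v vD0.
  have ind g : v 0 (enum_rank g) = 0.
    pose w (h : gal_of {:L}) := v 0 (enum_rank h).
    apply: (@gal_independent _ _ {:L} xpredT w) => // a _; rewrite /w.
    rewrite (coord_vbasis (memvf a)).
    under eq_bigr do rewrite linear_sum /= mulr_sumr.
    rewrite exchange_big /= big1 // => j _.
    under eq_bigr do rewrite linearZ /= -scalerAr.
    rewrite -scaler_sumr; apply/eqP; rewrite scaler_eq0; apply/orP; right.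
    have /matrixP/(_ 0 j) := vD0; rewrite mxE [RHS]mxE => vDj.
    apply/eqP; apply: etrans vDj.
    rewrite (reindex (@enum_val (gal_of {:L}) {: gal_of {:L}})) /=; last first.
      by apply: onW_bij; apply: enum_val_bij.
    by apply: eq_bigr => i _; rewrite mxE enum_valK.
  by apply/rowP => i; rewrite mxE -(enum_valK i) ind.
have [D' DD'] := row_freeP freeD.
exists d, b, (fun j => D' j (enum_rank 1%g)) => g.
have /matrixP/(_ (enum_rank g) (enum_rank 1%g)) := DD'.
rewrite !mxE (inj_eq enum_rank_inj) => <-.
by apply/eq_bigr => j _; rewrite mxE enum_rankK mulrC.
Qed.

Lemma exists_galTrace1 : exists c : L, \sum_(g : gal_of {:L}) g c = 1.
Proof.
have [c _ c0] := @gal_independent_contra _ _ {:L} xpredT (fun=> 1) 1%g isT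
  (oner_neq0 _).
move: c0; under eq_bigr do rewrite mul1r; set t := \sum_y _ => t0.
have tG (h : gal_of {:L}) : h t = t.
  rewrite rmorph_sum [RHS](reindex_inj (mulIg h)) /=.
  by apply/eq_bigr => g _; rewrite gal_mulE.
exists (c / t); rewrite -[RHS](divff t0) mulr_suml.
by apply/eq_bigr => g _; rewrite fmorph_div /= [X in _ / X]tG.
Qed.

(** The trace on E^q, for the semilinear action of the Galois group that sends
    the l-th basis vector to the l-th row of A_g, maps c e_m to the vector
    sum_g g(c) A_g(m, _).  By duality of b and b', every basis vector e_l is the
    combination of the traces of the b_j e_l with the coefficients b'_j.  These
    traces therefore span E^q, and q of them form an invertible matrix. *)
Lemma galois_descent (E : fieldType) (cst : {rmorphism L -> E}) (q : nat)
    (A : gal_of {:L} -> 'M[E]_q) :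
  A 1%g = 1%:M ->
  exists (c : 'I_q -> L) (lam : 'I_q -> 'I_q),
    (\matrix_(r, l) \sum_(g : gal_of {:L}) cst (g (c r)) * A g (lam r) l)
      \in unitmx.
Proof.
move=> A1; have [d [b [b' bb']]] := gal_dual_basis.
pose I := ('I_d * 'I_q)%type.
pose N : 'M[E]_(#|{: I}|, q) := \matrix_(i, l)
  \sum_(g : gal_of {:L}) cst (g (b (enum_val i).1)) * A g (enum_val i).2 l.
have fullN : row_full N.
  apply/row_fullP.
  exists (\matrix_(l, i) (((enum_val i).2 == l)%:R * cst (b' (enum_val i).1))).
  apply/matrixP => l l'; rewrite -A1 !mxE.
  rewrite (reindex (@enum_rank I)) /=; last first.
    by apply: onW_bij; apply: enum_rank_bij.
  under eq_bigr do rewrite !mxE enum_rankK.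
  rewrite -(pair_bigA _ (fun j m => (m == l)%:R * cst (b' j) *
    (\sum_(g : gal_of {:L}) cst (g (b j)) * A g m l'))) /=.
  under eq_bigr => j _.
    rewrite (bigD1 l) //= eqxx mul1r [X in _ + X]big1 ?addr0 => [|m ml];
      last first.
      by rewrite (negbTE ml) mul0r mul0r.
    rewrite mulr_sumr.
    over.
  rewrite exchange_big /= (bigD1 1%g) //= [X in _ + X]big1 ?addr0 => [|g g1].
    under eq_bigr do rewrite mulrA -rmorphM.
    by rewrite -mulr_suml -rmorph_sum bb' eqxx rmorph1 mul1r.
  under eq_bigr do rewrite mulrA -rmorphM.
  by rewrite -mulr_suml -rmorph_sum bb' (negbTE g1) rmorph0 mul0r.
pose f := fullrankfun fullN.
exists (fun r => b (enum_val (f r)).1), (fun r => (enum_val (f r)).2).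
have := fullrowsub_unit fullN; congr (_ \in unitmx).
by apply/matrixP => r l; rewrite !mxE.
Qed.
End GaloisDescent.

Section InvariantFraction.
Context (k : fieldType) (L : splittingFieldType k).
Context (E : fieldType) (sigma : gal_of {:L} -> {rmorphism E -> E}).
Context (R : comNzRingType) (psi : {rmorphism R -> E}).
Context (act : gal_of {:L} -> {rmorphism R -> R}) (q : nat) (y : 'I_q -> E).
Hypothesis sigmaM : forall g h z, sigma (g * h)%g z = sigma h (sigma g z).
Hypothesis sigma_psi : forall g a, sigma g (psi a) = psi (act g a).
Hypothesis sigma_y : forall g i, sigma g (y i) = y i.
Local Notation Th := (mmap psi y).

Lemma sigma1 z : sigma 1%g z = z.
Proof. by apply: (fmorph_inj (sigma 1%g)); rewrite -sigmaM mulg1. Qed.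

Lemma sigma_mmap g p : sigma g (Th p) = Th (map_mpoly (act g) p).
Proof.
rewrite rmorph_mmap -map_mpolyEmmap rmorph_mmap; apply: eq_mmap => [a | i] /=.
  by rewrite mmapC sigma_psi.
by rewrite mmapX mmap1U sigma_y.
Qed.

Definition trace_coeffs (p : mpoly q R) :=
  forall m, exists r, p@_m = \sum_g act g r.

Variable c : R.
Hypothesis trace1 : \sum_g sigma g (psi c) = 1.

(** Multiplying an invariant element by the element c of trace one and summing
    over the group does not change its value, but makes its coefficients
    traces. *)
Lemma invariant_mmap p : (forall g, sigma g (Th p) = Th p) ->
  exists2 p', trace_coeffs p' & Th p = Th p'.
Proof.
move=> inv_p; exists (\sum_g map_mpoly (act g) (c *: p)).
  move=> m; exists (c * p@_m); rewrite raddf_sum /=.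
  by apply: eq_bigr => g _; rewrite mcoeff_map_mpoly mcoeffZ.
rewrite raddf_sum -[LHS]mul1r -trace1 mulr_suml; apply: eq_bigr => g _ /=.
by rewrite -sigma_mmap mmapZ rmorphM inv_p.
Qed.

(** Multiplying numerator and denominator by the other conjugates of the
    denominator makes the denominator a norm, hence invariant; the numerator is
    then invariant too. *)
Lemma invariant_fraction z a b : (forall g, sigma g z = z) ->
  Th b != 0 -> z = Th a / Th b ->
  exists a' b', [/\ trace_coeffs a', trace_coeffs b', Th b' != 0
                  & z = Th a' / Th b'].
Proof.
move=> inv_z b0 zE.
pose N := \prod_g map_mpoly (act g) b.
pose N' := \prod_(g | g != 1%g) map_mpoly (act g) b.
have ThN : Th N = \prod_g sigma g (Th b).
  by rewrite rmorph_prod; apply: eq_bigr => g _; rewrite sigma_mmap.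
have ThN' : Th N = Th b * Th N'.
  rewrite ThN (bigD1 1%g) //= sigma1; congr (_ * _).
  by rewrite rmorph_prod; apply: eq_bigr => g _; rewrite sigma_mmap.
have N0 : Th N != 0.
  by rewrite ThN; apply/prodf_neq0 => g _; rewrite fmorph_eq0.
have inv_N h : sigma h (Th N) = Th N.
  rewrite ThN rmorph_prod [RHS](reindex_inj (mulIg h)) /=.
  by apply: eq_bigr => g _; rewrite sigmaM.
have zE' : z = Th (a * N') / Th N.
  rewrite zE ThN' rmorphM -mulf_div divff ?mulr1 //.
  by apply: contraNneq N0 => e; rewrite ThN' e mulr0.
have inv_aN h : sigma h (Th (a * N')) = Th (a * N').
  have -> : Th (a * N') = z * Th N by rewrite zE' divfK.
  by rewrite rmorphM inv_z inv_N.
have [a' ta' ea] := invariant_mmap inv_aN.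
have [b' tb' eb] := invariant_mmap inv_N.
by exists a', b'; rewrite -ea -eb.
Qed.
End InvariantFraction.

(** * Group algebras and Laurent monomials *)

Section GroupAlgebraEval.
Context (R : comNzRingType) (M : zmodType) (T : comNzRingType).
Context (f : {rmorphism R -> T}) (x : M -> T).

(** The two properties of x are arguments, so that the evaluation is a ring
    morphism without further conditions. *)
Definition galg_eval (_ : x 0 = 1) (_ : {morph x : u v / u + v >-> u * v})
    (a : group_algebra R M) : T :=
  \sum_(u <- monalg.msupp a) f (monalg.mcoeff u a) * x u.

Hypothesis (x0 : x 0 = 1) (xD : {morph x : u v / u + v >-> u * v}).
Local Notation eval := (galg_eval x0 xD).

Lemma galg_evalw (d : {fset M}) (a : group_algebra R M) :
  monalg.msupp a `<=` d ->
  eval a = \sum_(u <- d) f (monalg.mcoeff u a) * x u.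
Proof.
move=> le; rewrite /galg_eval (big_fset_incl _ le) // => u _.
by move=> /monalg.mcoeff_outdom ->; rewrite rmorph0 mul0r.
Qed.

Lemma galg_evalU (c : R) (u : M) : eval (monalg.mkmalgU u c) = f c * x u.
Proof.
by rewrite (galg_evalw monalg.msuppU_le) big_seq_fset1 monalg.mcoeffUU.
Qed.

Lemma galg_evalD : {morph eval : a b / a + b}.
Proof.
move=> a b; rewrite (galg_evalw (monalg.msuppD_le a b)).
rewrite (galg_evalw (fsubsetUl (monalg.msupp a) (monalg.msupp b))).
rewrite (galg_evalw (fsubsetUr (monalg.msupp a) (monalg.msupp b))) -big_split /=.
by apply/eq_bigr => u _; rewrite monalg.mcoeffD rmorphD mulrDl.
Qed.

Lemma galg_eval0 : eval 0 = 0.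
Proof. by rewrite /galg_eval monalg.msupp0 big_seq_fset0. Qed.

Lemma galg_eval_sum (I : Type) (s : seq I) (F : I -> group_algebra R M) :
  eval (\sum_(i <- s) F i) = \sum_(i <- s) eval (F i).
Proof. exact: (big_morph eval galg_evalD galg_eval0). Qed.

Fact galg_eval_is_zmod_morphism : zmod_morphism eval.
Proof.
move=> a b; rewrite galg_evalD; congr (_ + _).
by apply/eqP; rewrite -addr_eq0 -galg_evalD addNr galg_eval0.
Qed.

Fact galg_eval_is_monoid_morphism : monoid_morphism eval.
Proof.
split=> [|a b]; first by rewrite galg_evalU rmorph1 x0 mul1r.
rewrite [a * b]/(galg_mul a b) galg_eval_sum.
rewrite [X in _ = X * _]/galg_eval mulr_suml; apply: eq_bigr => u _.
rewrite galg_eval_sum [X in _ = _ * X]/galg_eval mulr_sumr.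
by apply: eq_bigr => v _; rewrite galg_evalU rmorphM xD mulrACA.
Qed.

HB.instance Definition _ := GRing.isZmodMorphism.Build (group_algebra R M) T
  eval galg_eval_is_zmod_morphism.
HB.instance Definition _ := GRing.isMonoidMorphism.Build (group_algebra R M) T
  eval galg_eval_is_monoid_morphism.
End GroupAlgebraEval.

Section Laurent.
Context (E : fieldType) (p : nat) (x : 'I_p -> E).

Definition laurent (v : 'rV[int]_p) : E := \prod_j x j ^ (v 0 j).

Lemma laurent0 : laurent 0 = 1.
Proof. by rewrite /laurent big1 // => j _; rewrite mxE expr0z. Qed.

Hypothesis x_neq0 : forall j, x j != 0.

Lemma laurentD : {morph laurent : u v / u + v >-> u * v}.
Proof.
move=> u v; rewrite /laurent -big_split /=.
by apply: eq_bigr => j _; rewrite mxE expfzDr.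
Qed.

Lemma laurent_delta j : laurent (delta_mx 0 j) = x j.
Proof.
rewrite /laurent (bigD1 j) //= mxE !eqxx expr1z big1 ?mulr1 // => i ij.
by rewrite mxE (negbTE ij) expr0z.
Qed.

Lemma laurent_perm (s : {rmorphism E -> E}) (pi : 'I_p -> 'I_p)
    (P : 'M[int]_p) (v : 'rV[int]_p) :
  (forall j, s (x j) = x (pi j)) -> (forall j, row j P = delta_mx 0 (pi j)) ->
  s (laurent v) = laurent (v *m P).
Proof.
move=> sx rowP; rewrite rmorph_prod.
have -> : v *m P = \sum_j v 0 j *: delta_mx 0 (pi j).
  by rewrite mulmx_sum_row; apply: eq_bigr => j _; rewrite rowP.
have -> : laurent (\sum_j v 0 j *: delta_mx 0 (pi j)) =
    \prod_j laurent (v 0 j *: delta_mx 0 (pi j)).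
  exact: (big_morph laurent laurentD laurent0).
apply: eq_bigr => j _; rewrite rmorphXz /= ?sx ?unitfE //.
rewrite /laurent (bigD1 (pi j)) //= !mxE !eqxx mulr1 big1 ?mulr1 // => i ij.
by rewrite !mxE (negbTE ij) andbF mulr0 expr0z.
Qed.

Variables (L : comNzRingType) (cst : {rmorphism L -> E}).
Hypothesis x_inj : injective (mmap cst x).

(** Multiplying by a high power of the product of the x_j turns a relation
    between Laurent monomials into a polynomial relation. *)
Lemma laurent_eval_inj : injective (galg_eval cst laurent0 laurentD).
Proof.
apply: raddf_inj => a ea0.
pose S : seq 'rV[int]_p := monalg.msupp a.
(* Large enough for v + N to have nonnegative entries for all v in S. *)
pose N := (\sum_(v <- S) \sum_j `|v 0%R j|)%N.
have leN v j : v \in S -> 0 <= v 0 j + N%:Z.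
  move=> vS.
  have : (`|v 0%R j| <= N)%N.
    rewrite /N (big_rem v vS) /= (bigD1 j) //= -addnA; exact: leq_addr.
  by lia.
pose m (v : 'rV[int]_p) := [multinom absz (v 0%R j + N%:Z)%R | j < p].
have m_inj v w : v \in S -> w \in S -> m v = m w -> v = w.
  move=> vS wS /mnmP e; apply/rowP => j; have := e j; rewrite !mnmE.
  move=> /(congr1 Posz); rewrite !gez0_abs ?leN //.
  exact: addIr.
pose D : mpoly p L := \sum_(v <- S) monalg.mcoeff v a *: 'X_[m v].
have D0 : D = 0.
  apply: x_inj; rewrite rmorph0 raddf_sum /=.
  transitivity ((\prod_j x j ^+ N) * galg_eval cst laurent0 laurentD a).
    rewrite mulr_sumr; apply: eq_big_seq => v vS.
    rewrite mmapZ mmapX mulrCA; congr (_ * _).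
    rewrite /laurent -big_split /=; apply: eq_bigr => j _.
    rewrite mnmE -[x j ^+ N]/(x j ^ N%:Z) -expfzDr // [N%:Z + _]addrC.
    by rewrite -[in RHS](gez0_abs (leN v j vS)).
  by rewrite ea0 mulr0.
apply/malgP => v; rewrite monalg.mcoeff0.
have [vS | ] := boolP (v \in monalg.msupp a); last first.
  exact: monalg.mcoeff_outdom.
have := congr1 (mcoeff (m v)) D0.
rewrite raddf_sum /= mcoeff0 (big_rem v vS) /= mcoeffZ mcoeffX eqxx mulr1.
rewrite big1_seq ?addr0 // => w /andP[_ wS].
have /andP[wv wS'] : (w != v) && (w \in S).
  by move: wS; rewrite mem_rem_uniq ?fset_uniq // inE.
rewrite mcoeffZ mcoeffX; case: eqP => [/m_inj e | _]; last by rewrite mulr0.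
by rewrite e ?eqxx in wv.
Qed.
End Laurent.

Lemma laurentZ (E : fieldType) (p : nat) (x : 'I_p -> E) (z : int)
    (v : 'rV[int]_p) :
  laurent x (z *: v) = laurent x v ^ z.
Proof.
rewrite /laurent.
have expM (a b : E) : (a * b) ^ z = a ^ z * b ^ z by apply: expfzMl.
rewrite (big_morph (fun a : E => a ^ z) expM (exp1rz _ z)).
by apply: eq_bigr => j _; rewrite mxE mulrC exprz_exp.
Qed.

Lemma laurent_mulmx (E : fieldType) (p m : nat) (x : 'I_p -> E) (v : 'rV[int]_m)
    (A : 'M[int]_(m, p)) :
  (forall j, x j != 0) ->
  laurent x (v *m A) = laurent (fun l => laurent x (row l A)) v.
Proof.
move=> x0; rewrite mulmx_sum_row.
rewrite (big_morph (laurent x) (laurentD x0) (laurent0 x)).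
by apply: eq_bigr => l _; rewrite laurentZ.
Qed.

(** * Fractions of the image of a ring morphism *)

Section Ratios.
Context (S : comNzRingType) (E : fieldType) (Th : {rmorphism S -> E}).

Definition is_ratio z := exists a b, Th b != 0 /\ z = Th a / Th b.

Lemma is_ratio_img a : is_ratio (Th a).
Proof. by exists a, 1; rewrite rmorph1 divr1 oner_neq0. Qed.

Lemma is_ratioD y z : is_ratio y -> is_ratio z -> is_ratio (y + z).
Proof.
move=> [a [b [b0 ->]]] [c [d [d0 ->]]]; exists (a * d + c * b), (b * d).
by rewrite rmorphM mulf_neq0 // addf_div // rmorphD !rmorphM.
Qed.

Lemma is_ratioM y z : is_ratio y -> is_ratio z -> is_ratio (y * z).
Proof.
move=> [a [b [b0 ->]]] [c [d [d0 ->]]]; exists (a * c), (b * d).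
by rewrite !rmorphM mulf_neq0 // mulf_div.
Qed.

Lemma is_ratioV y : is_ratio y -> is_ratio y^-1.
Proof.
move=> [a [b [b0 ->]]]; have [a0 | a0] := eqVneq (Th a) 0.
  by rewrite a0 mul0r invr0 -[0](rmorph0 Th); apply: is_ratio_img.
by exists b, a; rewrite invf_div.
Qed.

Lemma is_ratio_sum (I : Type) (r : seq I) (P : pred I) (F : I -> E) :
  (forall i, P i -> is_ratio (F i)) -> is_ratio (\sum_(i <- r | P i) F i).
Proof.
move=> rF; apply: big_ind => //; last exact: is_ratioD.
by rewrite -[0](rmorph0 Th); apply: is_ratio_img.
Qed.

Lemma is_ratio_prod (I : Type) (r : seq I) (P : pred I) (F : I -> E) :
  (forall i, P i -> is_ratio (F i)) -> is_ratio (\prod_(i <- r | P i) F i).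
Proof.
move=> rF; apply: big_ind => //; last exact: is_ratioM.
by rewrite -[1](rmorph1 Th); apply: is_ratio_img.
Qed.

Lemma is_ratioX y m : is_ratio y -> is_ratio (y ^+ m).
Proof.
move=> ry; elim: m => [|m IHm]; last by rewrite exprS; apply: is_ratioM.
by rewrite expr0 -(rmorph1 Th); apply: is_ratio_img.
Qed.

Lemma is_ratioXz y (z : int) : is_ratio y -> is_ratio (y ^ z).
Proof.
by case: z => m ry; [|apply: is_ratioV]; apply: is_ratioX.
Qed.

Lemma is_ratio_laurent (p : nat) (x : 'I_p -> E) (v : 'rV[int]_p) :
  (forall j, is_ratio (x j)) -> is_ratio (laurent x v).
Proof. by move=> rx; apply: is_ratio_prod => j _; apply: is_ratioXz. Qed.
End Ratios.

(** * Generators of the function field over the group algebra *)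

(** In this section 0 -> M -> P -> Q -> 0 is a resolution with maps i and s,
    the Galois group permutes the standard bases of P and Q by pi and pi', st is
    a section of s as a map of abelian groups, and x is a family in E on which
    the group acts as on the basis of P. *)
Section TorusModel.
Context (k : fieldType) (L : splittingFieldType k) (n p q : nat).
Context (rho : gal_of {:L} -> 'M[int]_n).
Context (P : gal_of {:L} -> 'M[int]_p) (pi : gal_of {:L} -> 'I_p -> 'I_p).
Context (Q : gal_of {:L} -> 'M[int]_q) (pi' : gal_of {:L} -> 'I_q -> 'I_q).
Context (i : 'M[int]_(n, p)) (s : 'M[int]_(p, q)) (st : 'M[int]_(q, p)).
Hypothesis row_P : forall g j, row j (P g) = delta_mx 0 (pi g j).
Hypothesis row_Q : forall g j, row j (Q g) = delta_mx 0 (pi' g j).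
Hypothesis P1 : P 1%g = 1%:M.
Hypothesis Q1 : Q 1%g = 1%:M.
Hypothesis i_equiv : forall g, rho g *m i = i *m P g.
Hypothesis s_equiv : forall g, P g *m s = s *m Q g.
Hypothesis i_inj : forall u : 'rV_n, u *m i = 0 -> u = 0.
Hypothesis i_s : i *m s = 0.
Hypothesis ker_s :
  forall v : 'rV_p, v *m s = 0 -> exists u : 'rV_n, v = u *m i.
Hypothesis st_s : st *m s = 1%:M.

Context (E : fieldType) (sigma : gal_of {:L} -> {rmorphism E -> E}).
Context (cst : {rmorphism L -> E}) (x : 'I_p -> E).
Hypothesis sigmaM : forall g h z, sigma (g * h)%g z = sigma h (sigma g z).
Hypothesis sigma_cst : forall (g : gal_of {:L}) c, sigma g (cst c) = cst (g c).
Hypothesis x_neq0 : forall j, x j != 0.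
Hypothesis sigma_x : forall g j, sigma g (x j) = x (pi g j).
Hypothesis x_inj : injective (mmap cst x).

Local Notation R := (group_algebra L 'rV[int]_n).

Let chi (u : 'rV[int]_n) := laurent x (u *m i).

Fact torus_chi0 : chi 0 = 1.
Proof. by rewrite /chi mul0mx laurent0. Qed.

Fact torus_chiD : {morph chi : u v / u + v >-> u * v}.
Proof. by move=> u v; rewrite /chi mulmxDl laurentD. Qed.

Definition torus_eval : R -> E := galg_eval cst torus_chi0 torus_chiD.
HB.instance Definition _ := GRing.RMorphism.on torus_eval.

Lemma torus_evalU c u :
  torus_eval (monalg.mkmalgU u c) = cst c * laurent x (u *m i).
Proof. exact: galg_evalU. Qed.

Lemma sigma_torus_eval g a :
  sigma g (torus_eval a) = torus_eval (torus_act rho g a).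
Proof.
rewrite [torus_eval a]/galg_eval rmorph_sum /torus_act /galg_map raddf_sum /=.
apply: eq_bigr => u _; rewrite rmorphM sigma_cst torus_evalU; congr (_ * _).
by rewrite (laurent_perm x_neq0 _ (sigma_x g) (row_P g)) -!mulmxA i_equiv.
Qed.

Definition monomial (l : 'I_q) : E := laurent x (row l st).

(** The embedding in L[P] of the polynomial ring over L[M] whose variables are
    the monomials of the rows of st. *)
Definition expand (a : mpoly q R) : group_algebra L 'rV[int]_p :=
  \sum_(m <- msupp a) \sum_(u <- monalg.msupp a@_m)
    monalg.mkmalgU (u *m i + \row_l (m l)%:Z *m st) (monalg.mcoeff u a@_m).

Lemma mcoeff_expand w a : monalg.mcoeff w (expand a) =
  \sum_(m <- msupp a) \sum_(u <- monalg.msupp a@_m)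
    monalg.mcoeff u a@_m *+ (u *m i + \row_l (m l)%:Z *m st == w).
Proof.
rewrite /expand (raddf_sum (monalg.mcoeff w)); apply: eq_bigr => m _.
rewrite (raddf_sum (monalg.mcoeff w)); apply: eq_bigr => u _.
exact: monalg.mcoeffU.
Qed.

Lemma mmap_monomialE a :
  mmap torus_eval monomial a =
    galg_eval cst (laurent0 x) (laurentD x_neq0) (expand a).
Proof.
rewrite /expand raddf_sum; apply: eq_bigr => m _ /=.
rewrite raddf_sum [torus_eval _]/galg_eval mulr_suml; apply: eq_bigr => u _ /=.
rewrite galg_evalU laurentD // mulrA; congr (_ * _).
by rewrite laurent_mulmx //; apply: eq_bigr => l _; rewrite mxE.
Qed.

(** P is the direct sum of M and of the lattice spanned by the rows of st, so
    the exponents that occur in the expansion of a are distinct. *)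
Lemma monomial_inj : injective (mmap torus_eval monomial).
Proof.
apply: raddf_inj => a e.
have a0 : expand a = 0.
  apply: (laurent_eval_inj (x_neq0 := x_neq0) x_inj).
  by rewrite -mmap_monomialE raddf0; apply: e.
apply/mpolyP => m; rewrite mcoeff0; apply/malgP => u; rewrite monalg.mcoeff0.
have [ma | ] := boolP (m \in msupp a); last first.
  by move=> /memN_msupp_eq0 ->; rewrite monalg.mcoeff0.
have [ua | ] := boolP (u \in monalg.msupp a@_m); last first.
  exact: monalg.mcoeff_outdom.
pose w := u *m i + \row_l (m l)%:Z *m st.
have : monalg.mcoeff w (expand a) = 0 by rewrite a0 monalg.mcoeff0.
rewrite mcoeff_expand.
rewrite (bigD1_seq m ma (msupp_uniq a)) /=.
rewrite [X in X + _](bigD1_seq u ua (fset_uniq _)) /=.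
rewrite eqxx.
rewrite [X in _ + X + _]big1 => [|v vu]; last first.
  case: eqP => // /addIr /eqP.
  rewrite -subr_eq0 -mulmxBl => /eqP /i_inj /eqP; rewrite subr_eq0.
  by rewrite (negbTE vu).
rewrite big1 => [|m' m'm]; first by rewrite !addr0.
rewrite big1 // => v _; case: eqP => // /(congr1 (mulmx^~ s)).
rewrite !mulmxDl -!mulmxA i_s st_s !mulmx0 !add0r !mulmx1 => /rowP em.
case/eqP: m'm; apply/mnmP => l; have := em l; rewrite !mxE.
by case.
Qed.

Lemma torus_eval_inj : injective torus_eval.
Proof.
move=> a b e; apply/eqP; rewrite -(mpolyC_eq q); apply/eqP/monomial_inj.
by rewrite !mmapC.
Qed.

(** The Galois group permutes the q monomials up to the factors laurent (w g l),
    which are the images of monomials of M since w g l is in the kernel of s.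
    Descent for this cocycle gives invariant combinations t of the monomials.
    The matrix b of the combinations has entries in L[M] and a nonzero
    determinant, so t is algebraically independent over L[M] and, by the
    adjugate matrix, the monomials are fractions in t. *)
Lemma descent_generators : exists t : 'I_q -> E,
  [/\ forall g r, sigma g (t r) = t r,
      injective (mmap torus_eval t)
    & forall v, is_ratio (mmap torus_eval t) (laurent x v)].
Proof.
(* The defect of equivariance of st; it lies in M because s is equivariant. *)
pose w g l := row l st *m P g - row (pi' g l) st.
have [u wE] : exists u : gal_of {:L} * 'I_q -> 'rV[int]_n,
    forall y, w y.1 y.2 = u y *m i.
  apply: (@fin_all_exists _ _ (fun y u => w y.1 y.2 = u *m i)) => -[g l] /=.
  apply: ker_s; rewrite mulmxBl -mulmxA s_equiv mulmxA -!row_mul st_s.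
  by rewrite mul1mx row_Q row1 subrr.
pose A g := \matrix_(l, l') ((l' == pi' g l)%:R * laurent x (u (g, l) *m i)).
have A1 : A 1%g = 1%:M.
  have pi1 l : pi' 1%g l = l.
    have := row_Q 1%g l; rewrite Q1 row1 => /rowP/(_ l); rewrite !mxE !eqxx.
    by case: eqP.
  apply/matrixP => l l'; rewrite !mxE pi1 eq_sym -(wE (1%g, l)) /w /=.
  rewrite pi1 P1 mulmx1.
  by rewrite subrr laurent0 mulr1.
have [c [lam uB]] := galois_descent cst A1.
pose b : 'M[R]_q := \matrix_(r, l) \sum_(g : gal_of {:L})
  monalg.mkmalgU (u (g, lam r)) ((l == pi' g (lam r))%:R * g (c r)).
have bE : map_mx torus_eval b = \matrix_(r, l)
    \sum_(g : gal_of {:L}) cst (g (c r)) * A g (lam r) l.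
  apply/matrixP => r l; rewrite !mxE raddf_sum; apply: eq_bigr => g _ /=.
  rewrite torus_evalU !mxE rmorphM rmorph_nat mulrA; congr (_ * _).
  by rewrite mulrC.
rewrite -bE in uB.
pose t r := \sum_l torus_eval (b r l) * monomial l.
have tE r : t r = \sum_(g : gal_of {:L}) sigma g (cst (c r) * monomial (lam r)).
  rewrite /t.
  under eq_bigr => l _.
    have /matrixP/(_ r l) := bE; rewrite !mxE => ->; rewrite mulr_suml.
    over.
  rewrite exchange_big; apply: eq_bigr => g _ /=.
  rewrite rmorphM sigma_cst (laurent_perm x_neq0 _ (sigma_x g) (row_P g)).
  rewrite (bigD1 (pi' g (lam r))) //= mxE eqxx mul1r -(wE (g, _)).
  rewrite -mulrA -laurentD //.
  rewrite /w /= subrK big1 ?addr0 // => l ne.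
  by rewrite mxE (negbTE ne) mul0r mulr0 mul0r.
exists t; split.
- move=> h r; rewrite tE rmorph_sum [RHS](reindex_inj (mulIg h)) /=.
  by apply: eq_bigr => g _; rewrite sigmaM.
- apply: (mmap_inj_linear torus_eval_inj uB _ monomial_inj) => r //.
pose Th := mmap torus_eval t.
have imgR a : is_ratio Th (torus_eval a).
  have <- : Th (@mpolyC q R a) = torus_eval a by rewrite /Th mmapC.
  exact: is_ratio_img.
have imgt r : is_ratio Th (t r).
  have <- : Th 'X_r = t r by rewrite /Th mmapX mmap1U.
  exact: is_ratio_img.
have imgm l : is_ratio Th (monomial l).
  have d0 : torus_eval (\det b) != 0.
    by rewrite -det_map_mx -unitfE.
  have -> : monomial l =
      (\sum_r torus_eval (\adj b l r) * t r) / torus_eval (\det b).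
    apply: (canRL (mulfK d0)).
    have /matrixP adjb := mul_adj_mx b.
    under eq_bigr do rewrite mulr_sumr.
    rewrite exchange_big /=.
    under eq_bigr => j _.
      under eq_bigr do rewrite mulrA -rmorphM.
      rewrite -mulr_suml -raddf_sum.
      have := adjb l j; rewrite !mxE => ->.
      over.
    rewrite (bigD1 l) //= eqxx mulr1n mulrC big1 ?addr0 // => j jl.
    by rewrite eq_sym (negbTE jl) mulr0n raddf0 mul0r.
  apply: is_ratioM; last by apply: is_ratioV.
  by apply: is_ratio_sum => r _; apply: is_ratioM.
move=> v.
have [z zE] : exists z, v - v *m s *m st = z *m i.
  by apply: ker_s; rewrite mulmxBl -[_ *m st *m s]mulmxA st_s mulmx1 subrr.
rewrite -[v](subrK (v *m s *m st)) zE laurentD //; apply: is_ratioM.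
  by rewrite -[laurent _ _]mul1r -(rmorph1 cst) -torus_evalU.
by rewrite laurent_mulmx //; apply: is_ratio_laurent.
Qed.
End TorusModel.

(** * The rational function field with its Galois action *)

Section FunctionField.
Context (k : fieldType) (L : splittingFieldType k) (p : nat).
Hypothesis galL : galois 1 {:L}.
Local Notation E := {fraction mpoly p L}.
Local Notation F := {fraction mpoly p k}.

Definition ff_const : L -> E := @FracField.tofrac _ \o @mpolyC p L.
HB.instance Definition _ := GRing.RMorphism.on ff_const.

Definition ff_var (r : 'I_p) : E := tofrac 'X_r.

Lemma mmap_ff_var (a : mpoly p L) : mmap ff_const ff_var a = tofrac a.
Proof. by rewrite -[in RHS](mmap_mpolyX a) rmorph_mmap. Qed.

Fact ff_gal_inj (g : gal_of {:L}) :
  injective (@FracField.tofrac (mpoly p L) \o map_mpoly (gal_repr g)).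
Proof. by apply: inj_comp (@tofrac_inj _) (map_mpoly_inj (fmorph_inj _)). Qed.

Definition ff_gal (g : gal_of {:L}) : E -> E := frac_lift (@ff_gal_inj g).
HB.instance Definition _ g := GRing.RMorphism.on (ff_gal g).

Fact ff_incl_inj :
  injective (@FracField.tofrac (mpoly p L) \o map_mpoly (in_alg L)).
Proof. by apply: inj_comp (@tofrac_inj _) (map_mpoly_inj (fmorph_inj _)). Qed.

Definition ff_incl : F -> E := frac_lift ff_incl_inj.
HB.instance Definition _ := GRing.RMorphism.on ff_incl.

Lemma ff_gal_tofrac g a :
  ff_gal g (tofrac a) = tofrac (map_mpoly (gal_repr g) a).
Proof. exact: frac_lift_tofrac. Qed.

Lemma ff_incl_tofrac a : ff_incl (tofrac a) = tofrac (map_mpoly (in_alg L) a).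
Proof. exact: frac_lift_tofrac. Qed.

Lemma ff_galM g h z : ff_gal (g * h)%g z = ff_gal h (ff_gal g z).
Proof.
apply: (@frac_morph_ext _ _ (ff_gal (g * h)%g) (ff_gal h \o ff_gal g)) => a /=.
rewrite !ff_gal_tofrac; congr tofrac; apply/mpolyP => m.
by rewrite !mcoeff_map_mpoly /= gal_mulE.
Qed.

Lemma ff_gal_const (g : gal_of {:L}) c : ff_gal g (ff_const c) = ff_const (g c).
Proof. by rewrite ff_gal_tofrac map_mpolyC. Qed.

Lemma ff_gal_var g r : ff_gal g (ff_var r) = ff_var r.
Proof. by rewrite ff_gal_tofrac map_mpolyX. Qed.

Lemma ff_gal_incl g w : ff_gal g (ff_incl w) = ff_incl w.
Proof.
apply: (@frac_morph_ext _ _ (ff_gal g \o ff_incl) ff_incl) => a /=.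
rewrite ff_incl_tofrac ff_gal_tofrac; congr tofrac; apply/mpolyP => m.
by rewrite !mcoeff_map_mpoly /= rmorph_alg.
Qed.

(** An invariant fraction has a numerator and a denominator whose coefficients
    are traces from L to k. *)
Lemma ff_gal_fixed z : (forall g, ff_gal g z = z) -> exists w, ff_incl w = z.
Proof.
move=> inv_z; have [c c1] := exists_galTrace1 L.
have tr1 : \sum_g ff_gal g (ff_const c) = 1.
  by under eq_bigr do rewrite ff_gal_const; rewrite -rmorph_sum c1 rmorph1.
have lift_trace (a : mpoly p L) : trace_coeffs (fun g => gal_repr g) a ->
    exists a', a = map_mpoly (in_alg L) a'.
  move=> ta; apply: mpoly_lift => m; have [r ->] := ta m.
  have : \sum_(g : gal_of {:L}) g r \in fixedField 'Gal({:L} / 1)%g.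
    apply/fixedFieldP => [|h _]; first exact: memvf.
    rewrite rmorph_sum [RHS](reindex_inj (mulIg h)) /=.
    by apply: eq_bigr => g _; rewrite gal_mulE.
  by rewrite (galois_fixedField galL) => /vlineP[d ->]; exists d.
have := fracE z; rewrite -!mmap_ff_var.
set a := \n__; set b := \d__ => zE.
have b0 : mmap ff_const ff_var b != 0.
  by rewrite mmap_ff_var tofrac_eq0 denom_ratioP.
have [a' [b' [ta tb b'0 zE']]] :=
  invariant_fraction ff_galM ff_gal_const ff_gal_var tr1 inv_z b0 zE.
have [a1 a1E] := lift_trace a' ta; have [b1 b1E] := lift_trace b' tb.
exists (tofrac a1 / tofrac b1).
by rewrite fmorph_div /= !ff_incl_tofrac -a1E -b1E -!mmap_ff_var.
Qed.
End FunctionField.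

Section TorusAct.
Context (k : fieldType) (L : splittingFieldType k) (n : nat).
Context (rho : gal_of {:L} -> 'M[int]_n) (g : gal_of {:L}).

Fact torus_act_is_zmod_morphism : zmod_morphism (torus_act rho g).
Proof. by move=> a b; rewrite /torus_act galg_mapD galg_mapN. Qed.

Fact torus_act_is_monoid_morphism : monoid_morphism (torus_act rho g).
Proof. by split=> [|a b]; [apply: galg_map1 | apply: galg_mapM]. Qed.

HB.instance Definition _ := GRing.isZmodMorphism.Build
  (group_algebra L 'rV[int]_n) (group_algebra L 'rV[int]_n) (torus_act rho g)
  torus_act_is_zmod_morphism.
HB.instance Definition _ := GRing.isMonoidMorphism.Build
  (group_algebra L 'rV[int]_n) (group_algebra L 'rV[int]_n) (torus_act rho g)
  torus_act_is_monoid_morphism.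
End TorusAct.

(** * Stable rationality from a permutation resolution *)

Section Model.
Context (k : fieldType) (L : splittingFieldType k) (n p q : nat).
Hypothesis galL : galois 1 {:L}.
Context (rho : gal_of {:L} -> 'M[int]_n).
Local Notation R := (group_algebra L 'rV[int]_n).
Local Notation E := {fraction mpoly p L}.
Local Notation F := {fraction mpoly p k}.
Local Notation cst := (@ff_const k L p).
Local Notation sigma := (@ff_gal k L p).
Local Notation incl := (@ff_incl k L p).
Context (phi : {rmorphism R -> E}) (t : 'I_q -> E).
Hypothesis sigma_phi : forall g a, sigma g (phi a) = phi (torus_act rho g a).
Hypothesis phi_const : forall c, phi (monalg.mkmalgU 0 c) = cst c.
Hypothesis phi_inj : injective phi.
Hypothesis sigma_t : forall g r, sigma g (t r) = t r.
Hypothesis t_indep : injective (mmap phi t).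
Hypothesis t_gen : forall z, is_ratio (mmap phi t) z.

Definition torus_val : {rmorphism torus_ring rho -> R} := \val.

Lemma torus_invariantP a :
  reflect (forall g, torus_act rho g a = a) (a \in torus_invariant rho).
Proof.
apply: (iffP forall_inP) => [inv_a g | inv_a g _]; last by apply/eqP.
by apply/eqP/inv_a/mem_gal.
Qed.

Lemma torus_trace_invariant a :
  \sum_g torus_act rho g a \in torus_invariant rho.
Proof.
apply/torus_invariantP => h; apply: phi_inj.
rewrite -sigma_phi !rmorph_sum [RHS](reindex_inj (mulIg h)) /=.
apply: eq_bigr => g _.
apply: etrans (congr1 (sigma h) (esym (sigma_phi g a))) _.
exact: etrans (esym (ff_galM g h (phi a))) (sigma_phi (g * h)%g a).
Qed.

(** The invariant elements phi a and t_r come from k(y_1, ..., y_p), which gives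
    the morphism from the polynomial ring over the coordinate ring; it is
    injective by independence of t, and every element of k(y_1, ..., y_p) is a
    fraction in its image because an invariant fraction has a numerator and a
    denominator with invariant coefficients. *)
Lemma stably_rational_model : torus_stably_rational rho.
Proof.
pose A := torus_ring rho.
have ex_h (a : A) : exists w, incl w == phi (torus_val a).
  have [|w <-] := ff_gal_fixed galL (z := phi (torus_val a)); last by exists w.
  by move=> g; rewrite sigma_phi; have /torus_invariantP-> := valP a.
pose h a := xchoose (ex_h a).
have hE a : incl (h a) = phi (torus_val a) by apply/eqP/(xchooseP (ex_h a)).
have incl_inj : injective incl by apply: fmorph_inj.
have h_zmod : zmod_morphism h.
  move=> a b; apply: incl_inj.
  rewrite hE (rmorphB torus_val) (rmorphB phi) -!hE.
  exact/esym/(rmorphB incl).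
have h_monoid : monoid_morphism h.
  split=> [|a b]; apply: incl_inj.
    by rewrite hE (rmorph1 torus_val) (rmorph1 phi); exact/esym/(rmorph1 incl).
  rewrite hE (rmorphM torus_val) (rmorphM phi) -!hE.
  exact/esym/(rmorphM incl).
pose hM : {rmorphism A -> F} := HB.pack h
  (GRing.isZmodMorphism.Build A F h h_zmod)
  (GRing.isMonoidMorphism.Build A F h h_monoid).
have ex_tau r : exists w, incl w == t r.
  by have [|w <-] := ff_gal_fixed galL (z := t r); last by exists w.
pose tau r := xchoose (ex_tau r).
have tauE r : incl (tau r) = t r by apply/eqP/(xchooseP (ex_tau r)).
pose f : {rmorphism mpoly q A -> F} := mmap hM tau.
have fE a : incl (f a) = mmap phi t (map_mpoly torus_val a).
  rewrite rmorph_mmap -map_mpolyEmmap rmorph_mmap.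
  apply: eq_mmap => [b | r] /=; first by rewrite mmapC hE.
  by rewrite mmapX mmap1U tauE.
exists q, p, f; split=> [a b e | c | z].
- have val_injM : injective torus_val := val_inj.
  apply: (map_mpoly_inj val_injM); apply: t_indep.
  exact: etrans (esym (fE a)) (etrans (congr1 incl e) (fE b)).
- apply: incl_inj; apply: etrans (fE _) _.
  rewrite ff_incl_tofrac !map_mpolyC mmapC.
  exact: phi_const.
have [c c1] := exists_galTrace1 L.
have tr1 : \sum_g sigma g (phi (monalg.mkmalgU 0 c)) = 1.
  under eq_bigr do rewrite phi_const ff_gal_const.
  by rewrite -rmorph_sum c1 rmorph1.
have [a [b [b0 zE]]] := t_gen (incl z).
have [a' [b' [ta tb b'0 zE']]] := invariant_fraction (@ff_galM k L p) sigma_phi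
  sigma_t tr1 (fun g => ff_gal_incl g z) b0 zE.
have lift_trace (d : mpoly q R) : trace_coeffs (torus_act rho) d ->
    exists d' : mpoly q A, d = map_mpoly torus_val d'.
  move=> td; apply: mpoly_lift => m; have [r ->] := td m.
  by exists (TorusRing (torus_trace_invariant r)).
have [a1 a1E] := lift_trace _ ta; have [b1 b1E] := lift_trace _ tb.
exists a1, b1; split.
  apply/eqP => b10; case/eqP: b'0; rewrite b1E b10.
  by rewrite (raddf0 (map_mpoly torus_val)) mmap0.
rewrite a1E b1E in zE'.
have incl_div u v (y w : E) :
    incl u = y -> incl v = w -> incl z = y / w -> z = u / v.
  by move=> <- <- e; apply: incl_inj; rewrite (fmorph_div incl).
exact: incl_div (fE a1) (fE b1) zE'.
Qed.
End Model.

Section Rationality.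
Context (k : fieldType) (L : splittingFieldType k) (n p q : nat).
Hypothesis galL : galois 1 {:L}.
Context (rho : gal_of {:L} -> 'M[int]_n).
Context (P : gal_of {:L} -> 'M[int]_p) (pi : gal_of {:L} -> 'I_p -> 'I_p).
Context (Q : gal_of {:L} -> 'M[int]_q) (pi' : gal_of {:L} -> 'I_q -> 'I_q).
Context (i : 'M[int]_(n, p)) (s : 'M[int]_(p, q)) (st : 'M[int]_(q, p)).
Hypothesis row_P : forall g j, row j (P g) = delta_mx 0 (pi g j).
Hypothesis row_Q : forall g j, row j (Q g) = delta_mx 0 (pi' g j).
Hypothesis P1 : P 1%g = 1%:M.
Hypothesis PM : forall g h, P (g * h)%g = P g *m P h.
Hypothesis Q1 : Q 1%g = 1%:M.
Hypothesis i_equiv : forall g, rho g *m i = i *m P g.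
Hypothesis s_equiv : forall g, P g *m s = s *m Q g.
Hypothesis i_inj : forall u : 'rV_n, u *m i = 0 -> u = 0.
Hypothesis i_s : i *m s = 0.
Hypothesis ker_s :
  forall v : 'rV_p, v *m s = 0 -> exists u : 'rV_n, v = u *m i.
Hypothesis st_s : st *m s = 1%:M.

Local Notation E := {fraction mpoly p L}.
Local Notation F := {fraction mpoly p k}.
Local Notation cst := (@ff_const k L p).
Local Notation Y := (@ff_var k L p).
Local Notation sigma := (@ff_gal k L p).

Lemma delta_mx_inj (m : nat) (j l : 'I_m) :
  delta_mx 0 j = delta_mx 0 l :> 'rV[int]_m -> j = l.
Proof.
by move/rowP/(_ l); rewrite !mxE !eqxx eq_sym; case: eqP.
Qed.

Lemma perm_idx1 j : pi 1%g j = j.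
Proof. by apply: delta_mx_inj; rewrite -row_P P1 row1. Qed.

Lemma perm_idxM g h j : pi (g * h)%g j = pi h (pi g j).
Proof.
by apply: delta_mx_inj; rewrite -row_P PM row_mul row_P -rowE row_P.
Qed.

Lemma perm_idx_inj g : injective (pi g).
Proof.
by apply: (can_inj (g := pi g^-1%g)) => j; rewrite -perm_idxM mulgV perm_idx1.
Qed.

(** Hilbert 90 for the permutation module P: the matrix B that descent gives for
    the permutation matrices satisfies h(B r l) = B r (pi h l). *)
Lemma permuted_coordinates : exists x : 'I_p -> E,
  [/\ forall g j, sigma g (x j) = x (pi g j), injective (mmap cst x)
    & forall r, exists c : 'I_p -> L, Y r = \sum_j cst (c j) * x j].
Proof.
pose A g : 'M[L]_p := \matrix_(j, l) (l == pi g j)%:R.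
have A1 : A 1%g = 1%:M.
  by apply/matrixP => j l; rewrite !mxE perm_idx1 eq_sym.
have [c [lam uB]] := galois_descent (idfun : {rmorphism L -> L}) A1.
set B := (\matrix_(r, l) _) in uB.
have galB (h : gal_of {:L}) r l : h (B r l) = B r (pi h l).
  rewrite !mxE rmorph_sum [RHS](reindex_inj (mulIg h)) /=.
  apply: eq_bigr => g _; rewrite rmorphM gal_mulE !mxE rmorph_nat.
  by rewrite perm_idxM (inj_eq (@perm_idx_inj h)).
pose x l := \sum_r cst (B r l) * Y r.
exists x; split=> [g j | | r].
- rewrite rmorph_sum; apply: eq_bigr => r _.
  by rewrite rmorphM /= ff_gal_const ff_gal_var galB.
- apply: (@mmap_inj_linear _ _ _ cst Y x B^T) => [||r|].
  + exact: fmorph_inj.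
  + by rewrite map_unitmx unitmx_tr.
  + by apply: eq_bigr => l _; rewrite [B^T _ _]mxE.
  by move=> a b; rewrite !mmap_ff_var => /tofrac_inj.
exists (fun j => (invmx B)^T r j).
have /matrixP BV := mulmxV uB.
under eq_bigr do rewrite mulr_sumr.
rewrite exchange_big (bigD1 r) //= [X in _ + X]big1 ?addr0 => [|l lr].
  under eq_bigr do rewrite mulrA -rmorphM mulrC.
  rewrite -mulr_sumr -rmorph_sum /=.
  have := BV r r; rewrite !mxE eqxx => BVr.
  under eq_bigr do rewrite mxE mulrC.
  by rewrite BVr rmorph1 mulr1.
under eq_bigr do rewrite mulrA -rmorphM mulrC.
rewrite -mulr_sumr -rmorph_sum /=.
have := BV l r; rewrite !mxE (negbTE lr) => BVr.
under eq_bigr do rewrite mxE mulrC.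
by rewrite BVr rmorph0 mulr0.
Qed.

Theorem torus_stably_rational_of_permutation : torus_stably_rational rho.
Proof.
have [x [sigma_x x_inj x_gen]] := permuted_coordinates.
have x0 j : x j != 0.
  apply/eqP => xj0.
  have : mmap cst x 'X_j = mmap cst x 0 by rewrite mmapX mmap1U xj0 mmap0.
  move/x_inj/(congr1 (mcoeff U_(j))); rewrite mcoeffX eqxx mcoeff0.
  by move/eqP; rewrite oner_eq0.
have [t [sigma_t Th_inj gen_t]] := descent_generators row_P row_Q P1 Q1
  s_equiv i_inj i_s ker_s st_s (@ff_galM k L p) (@ff_gal_const k L p)
  x0 sigma_x x_inj.
have sigma_phi :=
  sigma_torus_eval row_P i_equiv (@ff_gal_const k L p) x0 sigma_x.
have phi_inj : injective (torus_eval i cst x0).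
  exact: (torus_eval_inj i_inj i_s st_s x_inj).
apply: (stably_rational_model galL sigma_phi _ phi_inj sigma_t Th_inj).
  move=> c; apply: etrans (torus_evalU i cst x0 c 0) _.
  by rewrite mul0mx laurent0 mulr1.
set Th := mmap (torus_eval i cst x0) t in gen_t *.
have gen_c c : is_ratio Th (cst c).
  by rewrite -[cst c]mulr1 -(laurent0 x) -(mul0mx _ i) -torus_evalU -(mmapC t);
    apply: is_ratio_img.
have gen_x j : is_ratio Th (x j).
  by rewrite -(laurent_delta x j).
have gen_Y r : is_ratio Th (Y r).
  have [c ->] := x_gen r.
  by apply: is_ratio_sum => j _; apply: is_ratioM.
have gen_tofrac (a : mpoly p L) : is_ratio Th (tofrac a).
  rewrite -mmap_ff_var; apply: is_ratio_sum => m _; apply: is_ratioM => //.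
  by apply: is_ratio_prod => r _; apply: is_ratioX.
move=> z; rewrite [z]fracE; apply: is_ratioM => //; exact: is_ratioV.
Qed.
End Rationality.

Section QuasiPermutation.
Context (gT : finGroupType) (G : {group gT}).

Lemma permutation_lattice_std (m : nat) (P : mx_representation int G m) :
  permutation_lattice P -> exists2 B : 'M[int]_m, B \in unitmx &
    exists pi : gT -> 'I_m -> 'I_m,
      {in G, forall g j, row j (B *m P g *m invmx B) = delta_mx 0 (pi g j)}.
Proof.
move=> [B uB permB]; exists B => //.
exists (fun g j => odflt j [pick l | row j B *m P g == row l B]) => g Gg j.
rewrite -mulmxA row_mul mulmxA.
case: pickP => [l /eqP -> | no] /=; last first.
  by have [l e] := permB g Gg j; have := no l; rewrite e eqxx.
by rewrite -row_mul mulmxV // row1.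
Qed.

(** Expressing P and Q in their permuted bases B and C, and lifting the basis C
    through the surjection s, puts the resolution in the form used above. *)
Theorem quasi_permutation_torus (n : nat) (M : mx_representation int G n)
    (k : fieldType) (L : splittingFieldType k)
    (phi : {morphism 'Gal({:L} / 1)%g >-> gT}) :
  quasi_permutation_lattice M -> galois 1 {:L} ->
  (forall g, phi g \in G) ->
  torus_stably_rational (fun g : gal_of {:L} => M (phi g)).
Proof.
move=> [p [q [P [Q [i [s [permP permQ iM sP exact_is]]]]]]] galL phiG.
have [i_inj ker_s s_surj] := exact_is.
have [B uB [pi piE]] := permutation_lattice_std permP.
have [C uC [pi' piE']] := permutation_lattice_std permQ.
have phiM g h : phi (g * h)%g = (phi g * phi h)%g by rewrite morphM ?mem_gal.
have is0 : i *m s = 0.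
  apply/row_matrixP => j; rewrite row_mul row0; apply/ker_s.
  by exists (delta_mx 0 j); rewrite -rowE.
have [st stE] : exists st : 'M[int]_(q, p), st *m s = C.
  have [f fE] : exists f : 'I_q -> 'rV_p, forall l, row l C = f l *m s.
    apply: (@fin_all_exists _ _ (fun l v => row l C = v *m s)) => l.
    exact: s_surj.
  exists (\matrix_l f l); apply/row_matrixP => l.
  by rewrite row_mul rowK -fE.
apply: (@torus_stably_rational_of_permutation k L n p q galL _
  (fun g => B *m P (phi g) *m invmx B) (pi \o phi)
  (fun g => C *m Q (phi g) *m invmx C) (pi' \o phi)
  (i *m invmx B) (B *m s *m invmx C) (st *m invmx B)).
- by move=> g j; apply: piE.
- by move=> g j; apply: piE'.
- by rewrite morph1 repr_mx1 mulmx1 mulmxV.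
- by move=> g h; rewrite phiM repr_mxM // !mulmxA mulmxKV.
- by rewrite morph1 repr_mx1 mulmx1 mulmxV.
- by move=> g; rewrite !mulmxA mulmxKV // iM.
- by move=> g; rewrite !mulmxA !mulmxKV // -![B *m _ *m _]mulmxA sP //.
- move=> u; rewrite mulmxA => /(congr1 (mulmx^~ B)); rewrite mulmxKV // mul0mx.
  exact: i_inj.
- by rewrite !mulmxA mulmxKV // is0 mul0mx.
- move=> v; rewrite !mulmxA => /(congr1 (mulmx^~ C)); rewrite mulmxKV // mul0mx.
  by move/ker_s => [u uE]; exists u; rewrite mulmxA -uE mulmxK.
by rewrite !mulmxA mulmxKV // stE mulmxV.
Qed.
End QuasiPermutation.

(** * Matrices given by functions on indices *)

(** Sums over ordinals do not evaluate, so the identities between explicit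
    matrices are reduced to boolean tests on functions of natural numbers. *)
Definition mx_of_fun (m n : nat) (F : nat -> nat -> int) : 'M[int]_(m, n) :=
  \matrix_(a < m, b < n) F a b.

Definition fun_eqb (m n : nat) (F G : nat -> nat -> int) : bool :=
  all (fun a => all (fun b => F a b == G a b) (iota 0 n)) (iota 0 m).

Definition fun_mul (n : nat) (F G : nat -> nat -> int) (a b : nat) : int :=
  foldr (fun c z => F a c * G c b + z) 0 (iota 0 n).

Definition fun_one (a b : nat) : int := (a == b)%:Z.

Lemma fun_eqP m n F G : fun_eqb m n F G -> mx_of_fun m n F = mx_of_fun m n G.
Proof.
move/allP=> e; apply/matrixP => a b; rewrite !mxE; apply/eqP.
have iota_ord l (c : 'I_l) : (c : nat) \in iota 0 l by rewrite mem_iota ltn_ord.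
exact: (allP (e _ (iota_ord _ a)) _ (iota_ord _ b)).
Qed.

Lemma mx_of_fun_mul m n p F G :
  mx_of_fun m n F *m mx_of_fun n p G = mx_of_fun m p (fun_mul n F G).
Proof.
apply/matrixP => a b; rewrite !mxE /fun_mul.
under eq_bigr do rewrite !mxE.
rewrite -(big_mkord xpredT (fun c => F a c * G c b)) /index_iota subn0.
by elim: (iota 0 n) => [|c l IHl]; rewrite ?big_nil // big_cons /= IHl.
Qed.

Lemma mx_of_fun_one n : mx_of_fun n n fun_one = 1%:M.
Proof.
by apply/matrixP => a b; rewrite !mxE /fun_one -val_eqE; case: (_ == _).
Qed.

Definition table (s : seq (seq int)) (a b : nat) : int :=
  nth 0 (nth [::] s a) b.

Definition rows_of (A : 'M[int]_4) : seq (seq int) :=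
  mkseq (fun a => mkseq (fun b => A (inord a) (inord b)) 4) 4.

Lemma rows_elts_shape :
  all (fun s => s == mkseq (fun a => mkseq (table s a) 4) 4) rows_elts.
Proof. by vm_compute. Qed.

Lemma mx_of_rowsK s : s \in rows_elts -> rows_of (mx_of_rows 4 s) = s.
Proof.
move=> /(allP rows_elts_shape)/eqP e; rewrite [RHS]e.
by rewrite /rows_of /mkseq /= !mxE !inordK.
Qed.

Lemma mx_grp_rows (g : mx_grp) :
  rows_of (val g) \in rows_elts /\ val g = mx_of_rows 4 (rows_of (val g)).
Proof.
have /mapP[s es ->] := valP g; rewrite (mx_of_rowsK es).
split; [exact: es | exact: erefl].
Qed.

(** * Permutation lattices on finite sets of labels *)

Section LabelledPermutation.
Context (T : eqType) (x0 : T) (act : seq (seq int) -> T -> T) (labs : seq T).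
Local Notation m := (size labs).

Definition act_fun (s : seq (seq int)) (a b : nat) : int :=
  (act s (nth x0 labs a) == nth x0 labs b)%:Z.

Definition act_ok : bool :=
  [&& uniq labs, all (fun x => act rows1 x == x) labs,
      all (fun s => all (fun x => act s x \in labs) labs) rows_elts
    & allrel (fun s t =>
          all (fun x => act (rows_mul s t) x == act t (act s x)) labs)
        rows_elts rows_elts].

Definition act_mx (g : mx_grp) : 'M[int]_m :=
  mx_of_fun m m (act_fun (rows_of (val g))).

Hypothesis ok : act_ok.

Lemma row_act_mx g (a : 'I_m) : exists2 b : 'I_m,
  row a (act_mx g) = delta_mx 0 b
  & nth x0 labs b = act (rows_of (val g)) (nth x0 labs a).
Proof.
have [Es _] := mx_grp_rows g.
have /and4P[uniq_labs _ /allP/(_ _ Es)/allP cl _] := ok.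
have lab_a := cl _ (mem_nth x0 (ltn_ord a)).
have lt : (index (act (rows_of (val g)) (nth x0 labs a)) labs < m)%N.
  by rewrite index_mem.
have nth_b : nth x0 labs (Ordinal lt) = act (rows_of (val g)) (nth x0 labs a).
  exact: nth_index.
move: (Ordinal lt) nth_b => b nth_b; exists b; last exact: nth_b.
apply/rowP => c; rewrite !mxE /act_fun -nth_b.
rewrite (nth_uniq x0 (ltn_ord b) (ltn_ord c) uniq_labs) eqxx /= eq_sym -val_eqE.
by case: (_ == _).
Qed.

Lemma act_mx_repr : mx_repr G_4_25_8_5 act_mx.
Proof.
have /and4P[uniq_labs /allP one _ hom] := ok.
split=> [|g h _ _].
  apply/row_matrixP => a; have [b -> e] := row_act_mx 1%g a.
  rewrite row1; congr delta_mx; apply/val_inj/eqP.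
  rewrite -(nth_uniq x0 (ltn_ord b) (ltn_ord a) uniq_labs) e.
  have Er : rows1 \in rows_elts.
    exact: (allP rows_elts_gen _ (mem_head _ _)).
  have -> : rows_of (val (1%g : mx_grp)) = rows1.
    exact: etrans (congr1 rows_of (esym mx_of_rows1)) (mx_of_rowsK Er).
  exact: (one _ (mem_nth x0 (ltn_ord a))).
apply/row_matrixP => a; have [b -> eb] := row_act_mx (g * h)%g a.
have [c ec Ec] := row_act_mx g a; rewrite row_mul ec -rowE.
have [d -> ed] := row_act_mx h c; congr delta_mx; apply/val_inj/eqP.
rewrite -(nth_uniq x0 (ltn_ord b) (ltn_ord d) uniq_labs) eb ed Ec.
have [Eg eg] := mx_grp_rows g; have [Eh eh] := mx_grp_rows h.
have -> : rows_of (val (g * h)%g) =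
    rows_mul (rows_of (val g)) (rows_of (val h)).
  have Egh := allrelP rows_elts_mul _ _ Eg Eh.
  have vM : val (g * h)%g =
      mx_of_rows 4 (rows_mul (rows_of (val g)) (rows_of (val h))).
    exact: etrans (congr2 mulmx eg eh) (esym (mx_of_rowsM _ _)).
  exact: etrans (congr1 rows_of vM) (mx_of_rowsK Egh).
exact: (allP (allrelP hom _ _ Eg Eh) _ (mem_nth x0 (ltn_ord a))).
Qed.

Definition act_rep : mx_representation int G_4_25_8_5 m :=
  MxRepresentation act_mx_repr.

Lemma act_rep_permutation : permutation_lattice act_rep.
Proof.
exists 1%:M; first exact: unitmx1.
move=> g _ a; have [b e _] := row_act_mx g a; exists b.
by rewrite !row1 -rowE.
Qed.
End LabelledPermutation.

(** * The resolution of the lattice *)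

(** An element of G, given by its rows, sends e_1 to +-e_1 modulo the span N of
    e_2, e_3, e_4, and acts on N by a signed permutation of the three axes. *)
Definition flips (s : seq (seq int)) : bool := table s 0 0 == -1.
Definition axis (s : seq (seq int)) (i : nat) : nat :=
  find (fun z => z != 0) (behead (nth [::] s i.+1)).
Definition reverses (s : seq (seq int)) (i : nat) : bool :=
  -1 \in nth [::] s i.+1.

Definition signs : seq bool := [:: false; true].

(** In the notation of the introduction, and with [false] for the sign +, the
    labels stand for the vectors +-e_0 (sign e), the vectors (+-e_0 +- v_i) / 2
    (signs e and d), and the three axes. *)
Definition P_label : eqType := (bool + nat * bool * bool + nat)%type.
Definition P_labels : seq P_label :=
  [seq inl (inl e) | e <- signs] ++
  [seq inl (inr (ie, d)) | ie <- [seq (i, e) | i <- iota 0 3, e <- signs],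
                           d <- signs] ++
  [seq inr i | i <- iota 0 3].
Definition P_act (s : seq (seq int)) (x : P_label) : P_label :=
  match x with
  | inl (inl e) => inl (inl (flips s (+) e))
  | inl (inr (i, e, d)) =>
      inl (inr (axis s i, flips s (+) e, reverses s i (+) d))
  | inr i => inr (axis s i)
  end.

(** The labels stand for the pairs x, -x among the twelve vectors on the axis i
    (h tells whether the two signs of x differ), for the pairs of vectors on the
    axis i with the same sign e of e_0, and for the pair +-e_0. *)
Definition Q_label : eqType := (nat * bool + nat * bool + unit)%type.
Definition Q_labels : seq Q_label :=
  [seq inl (inl (i, h)) | i <- iota 0 3, h <- signs] ++
  [seq inl (inr (i, e)) | i <- iota 0 3, e <- signs] ++ [:: inr tt].
Definition Q_act (s : seq (seq int)) (x : Q_label) : Q_label :=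
  match x with
  | inl (inl (i, h)) => inl (inl (axis s i, flips s (+) reverses s i (+) h))
  | inl (inr (i, e)) => inl (inr (axis s i, flips s (+) e))
  | inr tt => inr tt
  end.

(** The column of a label is the vector of M_4^* that it stands for, in the
    basis dual to e_1, ..., e_4; the columns of the axes are zero. *)
Definition incl_rows : seq (seq int) :=
  [:: [:: 1; -1; 1; 0; 0; -1; 0; 1; -1; 0; 0; 1; -1; 0; 0; 0; 0];
      [:: 0; 0; 1; -1; 1; -1; 0; 0; 0; 0; 0; 0; 0; 0; 0; 0; 0];
      [:: 0; 0; 0; 0; 0; 0; 1; -1; 1; -1; 0; 0; 0; 0; 0; 0; 0];
      [:: 0; 0; 0; 0; 0; 0; 0; 0; 0; 0; 1; -1; 1; -1; 0; 0; 0]].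

(** The columns are the 13 basis elements of the kernel of the map from the free
    module on the labels of P to M_4^*.  The column of a pair on the axis i with
    sign e of e_0 has in addition a coefficient 1 on the axis i + 1 (for +) or
    i + 2 (for -) modulo 3, and the column of the pair +-e_0 has the coefficient
    -1 on the three axes.  Then the sum of the two columns of opposite pairs on
    the axis i, minus those of the two pairs with a common sign of e_0 and minus
    the last column, is the basis vector of that axis: this is the equivariant
    splitting. *)
Definition proj_rows : seq (seq int) :=
  [:: [:: 0; 0; 0; 0; 0; 0; -1; 0; -1; 0; -1; 0; 1];
      [:: 0; 0; 0; 0; 0; 0; 0; -1; 0; -1; 0; -1; 1];
      [:: 1; 0; 0; 0; 0; 0; 1; 0; 0; 0; 0; 0; 0];
      [:: 0; 1; 0; 0; 0; 0; 1; 0; 0; 0; 0; 0; 0];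
      [:: 0; 1; 0; 0; 0; 0; 0; 1; 0; 0; 0; 0; 0];
      [:: 1; 0; 0; 0; 0; 0; 0; 1; 0; 0; 0; 0; 0];
      [:: 0; 0; 1; 0; 0; 0; 0; 0; 1; 0; 0; 0; 0];
      [:: 0; 0; 0; 1; 0; 0; 0; 0; 1; 0; 0; 0; 0];
      [:: 0; 0; 0; 1; 0; 0; 0; 0; 0; 1; 0; 0; 0];
      [:: 0; 0; 1; 0; 0; 0; 0; 0; 0; 1; 0; 0; 0];
      [:: 0; 0; 0; 0; 1; 0; 0; 0; 0; 0; 1; 0; 0];
      [:: 0; 0; 0; 0; 0; 1; 0; 0; 0; 0; 1; 0; 0];
      [:: 0; 0; 0; 0; 0; 1; 0; 0; 0; 0; 0; 1; 0];
      [:: 0; 0; 0; 0; 1; 0; 0; 0; 0; 0; 0; 1; 0];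
      [:: 0; 0; 0; 0; 0; 0; 0; 0; 0; 1; 1; 0; -1];
      [:: 0; 0; 0; 0; 0; 0; 1; 0; 0; 0; 0; 1; -1];
      [:: 0; 0; 0; 0; 0; 0; 0; 1; 1; 0; 0; 0; -1]].

(** Together with [retract_rows], witnesses of exactness: a section of the
    projection and the complementary retraction of the inclusion. *)
Definition section_rows : seq (seq int) :=
  [:: [:: 0; 1; 0; 0; 0; 1; 0; 0; 0; 0; 0; -1; 1; 0; 1; 0; 0];
      [:: 0; 1; 0; 0; 1; 0; 0; 0; 0; 0; 0; -1; 1; 0; 1; 0; 0];
      [:: 0; 1; 0; -1; 1; 0; 0; 0; 0; 1; 0; 0; 0; 0; 0; 1; 0];
      [:: 0; 1; 0; -1; 1; 0; 0; 0; 1; 0; 0; 0; 0; 0; 0; 1; 0];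
      [:: 0; 1; 0; 0; 0; 0; 0; -1; 1; 0; 0; 0; 0; 1; 0; 0; 1];
      [:: 0; 1; 0; 0; 0; 0; 0; -1; 1; 0; 0; 0; 1; 0; 0; 0; 1];
      [:: -1; 0; 0; 0; 0; 0; -1; 0; 0; 1; 0; 0; 0; 0; -1; 0; 0];
      [:: 0; -1; 0; 0; 0; 0; 0; 0; 0; 0; 0; 1; -1; 0; -1; 0; 0];
      [:: -1; 0; 0; 0; 0; 0; 0; 0; 0; 0; -1; 0; 0; 1; 0; -1; 0];
      [:: 0; -1; 0; 1; -1; 0; 0; 0; 0; 0; 0; 0; 0; 0; 0; -1; 0];
      [:: -1; 0; -1; 0; 0; 1; 0; 0; 0; 0; 0; 0; 0; 0; 0; 0; -1];
      [:: 0; -1; 0; 0; 0; 0; 0; 1; -1; 0; 0; 0; 0; 0; 0; 0; -1];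
      [:: -1; -1; 0; 0; 0; 0; 0; 0; 0; 0; 0; 0; 0; 0; -1; -1; -1]].

Definition retract_rows : seq (seq int) :=
  [:: [:: -1; 0; -1; -1];
      [:: 1; -1; 0; 0];
      [:: 1; 0; 1; 0];
      [:: 1; -1; 1; 0];
      [:: 0; 0; 0; 0];
      [:: 0; 0; 0; 0];
      [:: 1; -1; 1; 1];
      [:: 1; -1; 0; 1];
      [:: 0; 0; 0; 0];
      [:: 0; 0; 0; 0];
      [:: 1; 0; 0; 1];
      [:: 1; 0; 0; 0];
      [:: 0; 0; 0; 0];
      [:: 0; 0; 0; 0];
      [:: 0; 1; 0; 0];
      [:: 0; 0; 1; 0];
      [:: 0; 0; 0; 1]].

Lemma P_act_ok : act_ok P_act P_labels.
Proof. by vm_compute. Qed.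

Lemma Q_act_ok : act_ok Q_act Q_labels.
Proof. by vm_compute. Qed.

Local Notation P_fun := (act_fun (inl (inl false)) P_act P_labels).
Local Notation Q_fun := (act_fun (inr tt) Q_act Q_labels).

Lemma incl_equiv : all (fun s => fun_eqb 4 17
  (fun_mul 4 (table s) (table incl_rows))
  (fun_mul 17 (table incl_rows) (P_fun s)))
  rows_elts.
Proof. by vm_compute. Qed.

Lemma proj_equiv : all (fun s => fun_eqb 17 13
  (fun_mul 17 (P_fun s) (table proj_rows))
  (fun_mul 13 (table proj_rows) (Q_fun s)))
  rows_elts.
Proof. by vm_compute. Qed.

Lemma M4_quasi_permutation : quasi_permutation_lattice M4.
Proof.
pose I := mx_of_fun 4 17 (table incl_rows).
pose S := mx_of_fun 17 13 (table proj_rows).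
pose J := mx_of_fun 17 4 (table retract_rows).
pose T := mx_of_fun 13 17 (table section_rows).
have IJ : I *m J = 1%:M.
  by rewrite mx_of_fun_mul -mx_of_fun_one; apply: fun_eqP; vm_compute.
have TS : T *m S = 1%:M.
  by rewrite mx_of_fun_mul -mx_of_fun_one; apply: fun_eqP; vm_compute.
have IS : I *m S = 0.
  have -> : 0 = mx_of_fun 4 13 (fun _ _ => 0).
    by apply/matrixP => a b; rewrite !mxE.
  by rewrite mx_of_fun_mul; apply: fun_eqP; vm_compute.
have ST_JI : S *m T + J *m I = 1%:M.
  rewrite !mx_of_fun_mul -mx_of_fun_one.
  set F := fun_mul _ _ _; set G := fun_mul _ _ _.
  have -> : mx_of_fun 17 17 F + mx_of_fun 17 17 G =
      mx_of_fun 17 17 (fun a b => F a b + G a b).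
    by apply/matrixP => a b; rewrite !mxE.
  by apply: fun_eqP; vm_compute.
exists (size P_labels), (size Q_labels).
exists (act_rep (inl (inl false)) P_act_ok), (act_rep (inr tt) Q_act_ok).
exists I, S.
split.
- exact: act_rep_permutation.
- exact: act_rep_permutation.
- move=> g _; have [Eg eg] := mx_grp_rows g.
  have -> : M4 g = mx_of_fun 4 4 (table (rows_of (val g))) by exact: eg.
  apply: etrans (mx_of_fun_mul 4 4 17 _ _) _.
  apply: etrans (fun_eqP (allP incl_equiv _ Eg)) _.
  exact: esym (mx_of_fun_mul 4 17 17 (table incl_rows) (P_fun _)).
- move=> g _; have [Eg _] := mx_grp_rows g.
  apply: etrans (mx_of_fun_mul 17 17 13 (P_fun _) _) _.
  apply: etrans (fun_eqP (allP proj_equiv _ Eg)) _.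
  exact: esym (mx_of_fun_mul 17 13 13 (table proj_rows) (Q_fun _)).
split=> [u uI0 | v | w].
- by rewrite -[u]mulmx1 -IJ mulmxA uI0 mul0mx.
- split=> [vS0 | [u ->]]; last by rewrite -mulmxA IS mulmx0.
  exists (v *m J).
  by rewrite -[LHS]mulmx1 -ST_JI mulmxDr !mulmxA vS0 mul0mx add0r.
by exists (w *m T); rewrite -mulmxA TS mulmx1.
Qed.

Theorem mainTheorem7 :
  quasi_permutation_lattice M4 /\
  (forall (k : fieldType) (L : splittingFieldType k)
     (phi : {morphism 'Gal({:L} / 1)%g >-> mx_grp}),
     [pchar k] =i pred0 ->
     galois 1 {:L} ->
     isom 'Gal({:L} / 1)%g G_4_25_8_5 phi ->
     torus_stably_rational (fun g : gal_of {:L} => M4 (phi g))).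
Proof.
split=> [|k L phi _ galL /isomP[_ imphi]]; first exact: M4_quasi_permutation.
apply: quasi_permutation_torus M4_quasi_permutation galL _ => g.
by rewrite -imphi mem_morphim // mem_gal.
Qed.
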